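(* Let $H$ be a Hopf algebra with bijective antipode over a field $k$, and let $M$ be a left $H$-comodule and a right $H$-module. Then the map $$\tau_n(m\otimes_H(c_0\otimes\dots\otimes c_n))=m^{(0)}\otimes_H(c_1\otimes\dots\otimes c_n\otimes m^{(-1)}c_0)$$ is well defined on $M\otimes_HC^{\otimes(n+1)}$ for all $n\in\mathbb N$ and all left $H$-module coalgebras $C$ if and only if $M$ is an anti-Yetter-Drinfeld module. If furthermore $M$ is stable, then for every left $H$-module coalgebra $C$ the family $\{\mathcal C^n_H(C,M)\}_{n\in\mathbb N}$, $\mathcal C^n_H(C,M):=M\otimes_HC^{\otimes(n+1)}$, is a (co)cyclic module via $\tau_n$ and the maps $$\delta_i(m\otimes_H(c_0\otimes\dots\otimes c_{n-1}))=m\otimes_H(c_0\otimes\dots\otimes c_i^{(1)}\otimes c_i^{(2)}\otimes\dots\otimes c_{n-1}),\quad 0\le i<n,$$ $$\delta_n(m\otimes_H(c_0\otimes\dots\otimes c_{n-1}))=m^{(0)}\otimes_H(c_0^{(2)}\otimes c_1\otimes\dots\otimes c_{n-1}\otimes m^{(-1)}c_0^{(1)}),$$ $$\sigma_i(m\otimes_H(c_0\otimes\dots\otimes c_{n+1}))=m\otimes_H(c_0\otimes\dots\otimes c_i\otimes\varepsilon(c_{i+1})\otimes c_{i+2}\otimes\dots\otimes c_{n+1}),\quad 0\le i\le n.$$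
   Context: $\otimes=\otimes_k$; $\mathbb N=\{0,1,2,\dots\}$. $H$ has coproduct $\Delta(h)=h^{(1)}\otimes h^{(2)}$, counit $\varepsilon$, antipode $S$; the left coaction on $M$ is written ${}_M\Delta(m)=m^{(-1)}\otimes m^{(0)}$ (summation suppressed). A right $H$-module and left $H$-comodule $M$ is anti-Yetter-Drinfeld if ${}_M\Delta(mh)=S(h^{(3)})m^{(-1)}h^{(1)}\otimes m^{(0)}h^{(2)}$ for all $m\in M$, $h\in H$, and stable if $m^{(0)}m^{(-1)}=m$ for all $m\in M$. A left $H$-module coalgebra is a coalgebra $C$ that is a left $H$-module with $\Delta(hc)=h^{(1)}c^{(1)}\otimes h^{(2)}c^{(2)}$ and $\varepsilon(hc)=\varepsilon(h)\varepsilon(c)$. $C^{\otimes(n+1)}$ is a left $H$-module via the diagonal action $h(c_0\otimes\dots\otimes c_n)=h^{(1)}c_0\otimes\dots\otimes h^{(n+1)}c_n$. ''$\tau_n$ is well defined on $M\otimes_HC^{\otimes(n+1)}$'' means that the linear map $M\otimes C^{\otimes(n+1)}\to M\otimes C^{\otimes(n+1)}$, $m\otimes c_0\otimes\dots\otimes c_n\mapsto m^{(0)}\otimes c_1\otimes\dots\otimes c_n\otimes m^{(-1)}c_0$, descends to the quotient $M\otimes_HC^{\otimes(n+1)}$. The faces are maps $\delta_i:\mathcal C^{n-1}_H\to\mathcal C^n_H$ ($0\le i\le n$), the degeneracies are maps $\sigma_i:\mathcal C^{n+1}_H\to\mathcal C^n_H$ ($0\le i\le n$; the scalar $\varepsilon(c_{i+1})$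 is absorbed). ''(Co)cyclic module'' means that all these maps are well defined, $\delta_i,\sigma_i$ satisfy the cosimplicial identities, and $\tau_n\delta_i=\delta_{i-1}\tau_{n-1}$ for $1\le i\le n$, $\tau_n\delta_0=\delta_n$, $\tau_n\sigma_i=\sigma_{i-1}\tau_{n+1}$ for $1\le i\le n$, $\tau_n\sigma_0=\sigma_n\tau_{n+1}^2$, $\tau_n^{n+1}=\mathrm{id}$. *)

(* Defs.v *)
From HB Require Import structures.
From mathcomp Require Import all_boot all_order all_algebra.
From mathcomp Require Import boolp.
From mathcomp.multinomials Require Import freeg.

Set Implicit Arguments.
Unset Strict Implicit.
Unset Printing Implicit Defensive.

Import GRing.Theory.

Local Open Scope ring_scope.
Local Open Scope quotient_scope.

Reserved Notation "u *t v" (at level 40, left associativity).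
Reserved Notation "\sw_ ( a , b <- x ) E"
  (at level 41, a name, b name, E at level 41,
   format "'[' \sw_ ( a ,  b  <-  x ) '/  '  E ']'").
Reserved Notation "\swn_ ( c <- x ) E"
  (at level 41, c name, E at level 41,
   format "'[' \swn_ ( c  <-  x ) '/  '  E ']'").

Section ModQuotient.
Variables (k : fieldType) (V : lmodType k) (G : V -> Prop).

(* modq G is the quotient of V by the smallest submodule containing G *)
Definition span (x : V) : bool :=
  `[< forall P : V -> Prop,
        P 0 -> (forall a u v, P u -> P v -> P (a *: u + v)) ->
        (forall u, G u -> P u) -> P x >].

Lemma span_gen x : G x -> span x.
Proof. by move=> Gx; apply/asboolP => P _ _; apply. Qed.

Lemma span_closed : submod_closed span.
Proof.
split; first by apply/asboolP => P P0.
move=> a u v /asboolP hu /asboolP hv; apply/asboolP => P P0 PD PG.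
exact: PD (hu P P0 PD PG) (hv P P0 PD PG).
Qed.

HB.instance Definition _ := GRing.isSubmodClosed.Build k V span span_closed.

Local Notation spanC := (GRing.ZmodClosed.clone V span _).

Definition modq : Type := {ideal_quot spanC}.

HB.instance Definition _ := GRing.Zmodule.on modq.

Definition modpi (x : V) : modq := \pi_({ideal_quot spanC}) x.
Definition modrepr (x : modq) : V := repr (x : {ideal_quot spanC}).

Lemma modreprK x : modpi (modrepr x) = x.
Proof. exact: reprK. Qed.

Lemma modpi_eq x y : (modpi x = modpi y) <-> span (x - y).
Proof.
split; last by move=> h; apply/eqP; rewrite piE Quotient.equivE.
by move/eqP; rewrite piE Quotient.equivE.
Qed.

Lemma modpiB : {morph modpi : x y / x - y}.
Proof. by move=> x y; rewrite /modpi raddfB. Qed.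

Lemma modpiD : {morph modpi : x y / x + y}.
Proof. by move=> x y; rewrite /modpi raddfD. Qed.

Definition modq_scale (a : k) (x : modq) : modq := modpi (a *: modrepr x).

Lemma modpiZ a x : modpi (a *: x) = modq_scale a (modpi x).
Proof.
apply/modpi_eq; rewrite -scalerBr -[_ *: _]addr0.
have [h0 hD] := span_closed; apply: hD => //.
by apply/modpi_eq; rewrite modreprK.
Qed.

Lemma modq_scaleA a b x : modq_scale a (modq_scale b x) = modq_scale (a * b) x.
Proof. by rewrite -[x]modreprK -!modpiZ scalerA. Qed.

Lemma modq_scale1 : left_id 1 modq_scale.
Proof. by move=> x; rewrite -[x]modreprK -modpiZ scale1r. Qed.

Lemma modq_scaleDr : right_distributive modq_scale +%R.
Proof.
move=> a x y; rewrite -[x]modreprK -[y]modreprK.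
by rewrite -!(modpiZ, modpiD) scalerDr.
Qed.

Lemma modq_scaleDl x : {morph modq_scale^~ x : a b / a + b}.
Proof.
by move=> a b; rewrite -[x]modreprK -!(modpiZ, modpiD) scalerDl.
Qed.

HB.instance Definition _ := GRing.Zmodule_isLmodule.Build k modq
  modq_scaleA modq_scale1 modq_scaleDr modq_scaleDl.

Lemma modpi_linear : linear modpi.
Proof. by move=> a x y; rewrite modpiD modpiZ. Qed.

HB.instance Definition _ :=
  GRing.isLinear.Build k V modq *:%R modpi modpi_linear.

Lemma modpi_gen x : G x -> modpi x = 0.
Proof.
move=> Gx; rewrite -(raddf0 modpi); apply/modpi_eq; rewrite subr0.
exact: span_gen.
Qed.

Lemma modq_lift (W : lmodType k) (f : V -> W) : linear f ->
  (forall x, G x -> f x = 0) -> forall x, f (modrepr (modpi x)) = f x.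
Proof.
move=> fl fG x.
pose F := HB.pack_for {linear V -> W} f
  (GRing.isLinear.Build k V W *:%R f fl).
have /modpi_eq/asboolP h : modpi (modrepr (modpi x)) = modpi x by exact: modreprK.
apply/eqP; rewrite -subr_eq0 -(raddfB F); apply/eqP.
apply: (h (fun z => f z = 0)) => [|a u v hu hv|]; [exact: (raddf0 F)| |exact: fG].
by rewrite fl hu hv scaler0 addr0.
Qed.

End ModQuotient.

Lemma fglift_linear (k : fieldType) (K : choiceType) (W : lmodType k)
  (f : K -> W) : linear (fglift f : {freeg K / k} -> W).
Proof.
have fB := @lift_is_additive k K W f.
have f0 : fglift f 0 = 0 by rewrite -[0 in LHS](subrr 0) fB subrr.
have fD x y : fglift f (x + y) = fglift f x + fglift f y.
  have fN z : fglift f (- z) = - fglift f z by rewrite -sub0r fB f0 sub0r.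
  by rewrite -[y in LHS]opprK fB fN opprK.
have fsum (I : Type) (r : seq I) (F : I -> {freeg K / k}) :
    fglift f (\sum_(i <- r) F i) = \sum_(i <- r) fglift f (F i).
  by apply: (big_morph _ fD f0).
move=> a x y; rewrite fD; congr (_ + _).
rewrite [LHS](_ : _ = fglift f (\sum_(z <- dom x) << a * coeff z x *g z >>)) //.
by rewrite -[x in RHS]freeg_sumE !fsum scaler_sumr; apply: eq_bigr => z _;
   rewrite !liftU scalerA.
Qed.

HB.instance Definition _ (k : fieldType) (K : choiceType) (W : lmodType k)
  (f : K -> W) :=
  GRing.isLinear.Build k {freeg K / k} W *:%R (fglift f) (fglift_linear f).

Lemma lin_comb (k : fieldType) (U W : lmodType k) (f : U -> W) (I : Type)
  (s : seq (k * I)) (F : I -> U) : linear f ->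
  f (\sum_(p <- s) p.1 *: F p.2) = \sum_(p <- s) p.1 *: f (F p.2).
Proof.
move=> fl; elim: s => [|p s IH]; last by rewrite !big_cons fl IH.
by rewrite !big_nil; have := fl (-1) 0 0; rewrite scaler0 addr0 scaleN1r addNr.
Qed.

Section Tensor.
Variables (k : fieldType) (U V : lmodType k).

Local Notation gen u v := (<< 1 *g (u, v) >> : {freeg (U * V)%type / k}).

Inductive tensor_rel : {freeg (U * V)%type / k} -> Prop :=
| TensorRelL a u u' v :
    tensor_rel (gen (a *: u + u') v - (a *: gen u v + gen u' v))
| TensorRelR a u v v' :
    tensor_rel (gen u (a *: v + v') - (a *: gen u v + gen u v')).

Definition tensor : Type := modq tensor_rel.
HB.instance Definition _ := GRing.Lmodule.on tensor.

Definition tpair (u : U) (v : V) : tensor := modpi tensor_rel (gen u v).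

(* Sweedler notation: \sw_(u, v <- x) E is \sum_i E(u_i, v_i) for a chosen
   expression x = \sum_i u_i *t v_i; by tensor_lift_pair and
   tensor_lift_linear the choice is irrelevant as soon as E is bilinear *)
Definition tensor_lift (W : lmodType k) (f : U -> V -> W) (x : tensor) : W :=
  fglift (fun p => f p.1 p.2) (modrepr x).

Definition bilin (W : lmodType k) (f : U -> V -> W) : Prop :=
  (forall v, linear (f^~ v)) /\ (forall u, linear (f u)).

Lemma tpair_bilin : bilin tpair.
Proof.
split=> [v a u u'|u a v v']; apply/eqP; rewrite -subr_eq0 /tpair;
  rewrite -linearP -raddfB; apply/eqP/modpi_gen.
  exact: TensorRelL.
exact: TensorRelR.
Qed.

Section Lift.
Variables (W : lmodType k) (f : U -> V -> W) (fb : bilin f).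

Lemma tensor_lift_pi x :
  tensor_lift f (modpi tensor_rel x) = fglift (fun p => f p.1 p.2) x.
Proof.
apply: modq_lift; first exact: fglift_linear.
have [fl fr] := fb.
by move=> _ [a u u' v|a u v v'];
  rewrite linearB linearP /= !liftU /= !scale1r ?fl ?fr subrr.
Qed.

Lemma tensor_lift_linear : linear (tensor_lift f).
Proof.
move=> a x y; rewrite -[x]modreprK -[y]modreprK -linearP !tensor_lift_pi.
exact: fglift_linear.
Qed.

Lemma tensor_lift_pair u v : tensor_lift f (tpair u v) = f u v.
Proof. by rewrite tensor_lift_pi liftU scale1r. Qed.

End Lift.

Lemma tensor_sumE (x : tensor) : exists (s : seq (k * (U * V))),
  x = \sum_(p <- s) p.1 *: uncurry tpair p.2.
Proof.
pose y := modrepr x; exists [seq (coeff z y, z) | z <- dom y].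
rewrite -[LHS]modreprK -/y -[y in LHS]freeg_sumE linear_sum /dom !big_map.
apply: eq_bigr => -[a [u v]] _ /=; rewrite -linearZ; congr modpi.
by apply/eqP/freeg_eqP => z; rewrite coeffZ !coeffU mul1r.
Qed.

Lemma tensor_ext (W : lmodType k) (f g : tensor -> W) : linear f -> linear g ->
  (forall u v, f (tpair u v) = g (tpair u v)) -> f =1 g.
Proof.
move=> fl gl fg x; have [s ->] := tensor_sumE x.
by rewrite !lin_comb //; apply: eq_bigr => -[a [u v]] _; rewrite /= fg.
Qed.

End Tensor.

Notation "u *t v" := (tpair u v) : ring_scope.
Notation "\sw_ ( a , b <- x ) E" := (tensor_lift (fun a b => E) x) : ring_scope.

Section TensorPower.
Variables (k : fieldType) (C : lmodType k) (n : nat).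

Local Notation gen c := (<< 1 *g c >> : {freeg (n.-tuple C) / k}).

Definition upd (c : n.-tuple C) (i : 'I_n) (x : C) : n.-tuple C :=
  [tuple if j == i then x else tnth c j | j < n].

Inductive tpow_rel : {freeg (n.-tuple C) / k} -> Prop :=
| TpowRel c i a x y :
    tpow_rel (gen (upd c i (a *: x + y))
              - (a *: gen (upd c i x) + gen (upd c i y))).

Definition tpow : Type := modq tpow_rel.
HB.instance Definition _ := GRing.Lmodule.on tpow.

Definition tpure (c : n.-tuple C) : tpow := modpi tpow_rel (gen c).

(* c_0 *t ... *t c_(n-1) for a sequence [:: c_0; ...; c_(n-1)] of length n;
   other lengths are not used *)
Definition tseq (s : seq C) : tpow := tpure [tuple s`_j | j < n].

(* \swn_(c <- x) E is the analogue for x a sum of tensors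
   c_0 *t ... *t c_(n-1) and E multilinear in the tuple c *)
Definition tpow_lift (W : lmodType k) (f : n.-tuple C -> W) (x : tpow) : W :=
  fglift f (modrepr x).

Definition multilin (W : lmodType k) (f : n.-tuple C -> W) : Prop :=
  forall c i, linear (fun x => f (upd c i x)).

Lemma tpure_multilin : multilin tpure.
Proof.
move=> c i a x y; apply/eqP; rewrite -subr_eq0 /tpure.
by rewrite -linearP -raddfB; apply/eqP/modpi_gen/TpowRel.
Qed.

Section Lift.
Variables (W : lmodType k) (f : n.-tuple C -> W) (fm : multilin f).

Lemma tpow_lift_pi x : tpow_lift f (modpi tpow_rel x) = fglift f x.
Proof.
apply: modq_lift; first exact: fglift_linear.
by move=> _ [c i a x' y]; rewrite linearB linearP /= !liftU /= !scale1r fm subrr.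
Qed.

Lemma tpow_lift_linear : linear (tpow_lift f).
Proof.
move=> a x y; rewrite -[x]modreprK -[y]modreprK -linearP !tpow_lift_pi.
exact: fglift_linear.
Qed.

Lemma tpow_lift_pure c : tpow_lift f (tpure c) = f c.
Proof. by rewrite tpow_lift_pi liftU scale1r. Qed.

End Lift.

Lemma tpow_sumE (x : tpow) : exists (s : seq (k * n.-tuple C)),
  x = \sum_(p <- s) p.1 *: tpure p.2.
Proof.
pose y := modrepr x; exists [seq (coeff z y, z) | z <- dom y].
rewrite -[LHS]modreprK -/y -[y in LHS]freeg_sumE linear_sum /dom !big_map.
apply: eq_bigr => -[a c] _ /=; rewrite -linearZ; congr modpi.
by apply/eqP/freeg_eqP => z; rewrite coeffZ !coeffU mul1r.
Qed.

Lemma tpow_ext (W : lmodType k) (f g : tpow -> W) : linear f -> linear g ->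
  (forall c, f (tpure c) = g (tpure c)) -> f =1 g.
Proof.
move=> fl gl fg x; have [s ->] := tpow_sumE x.
by rewrite !lin_comb //; apply: eq_bigr => p _; rewrite fg.
Qed.

End TensorPower.

Notation "\swn_ ( c <- x ) E" := (tpow_lift (fun c => E) x) : ring_scope.

#[global] Arguments upd : simpl never.

Section Multilinearity.
Variable k : fieldType.
Implicit Types U V W X : lmodType k.

Lemma lin_comp U V W (f : V -> W) (g : U -> V) :
  linear f -> linear g -> linear (fun x => f (g x)).
Proof. by move=> fl gl a x y; rewrite gl fl. Qed.

Lemma fglift_fun_linear (K : choiceType) W X (f : X -> K -> W)
    (y : {freeg K / k}) :
  (forall z, linear (f^~ z)) -> linear (fun x => fglift (f x) y).
Proof.
move=> fl a x x'; rewrite -[y]freeg_sumE.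
have E (g : K -> W) : fglift g (\sum_(z <- dom y) << coeff z y *g z >>) =
    \sum_(z <- dom y) coeff z y *: g z.
  by rewrite linear_sum; apply: eq_bigr => z _; rewrite /= liftU.
rewrite !E scaler_sumr -big_split; apply: eq_bigr => z _ /=.
by rewrite fl scalerDr !scalerA [a * _]mulrC.
Qed.

Lemma tensor_lift_fun_linear U V W X (f : X -> U -> V -> W) y :
  (forall u v, linear (fun x => f x u v)) ->
  linear (fun x => tensor_lift (f x) y).
Proof. by move=> fl; apply: fglift_fun_linear => -[u v]; exact: fl. Qed.

Lemma tpow_lift_fun_linear U n W X (f : X -> n.-tuple U -> W) y :
  (forall c, linear (f^~ c)) -> linear (fun x => tpow_lift (f x) y).
Proof. exact: fglift_fun_linear. Qed.

Lemma tpairl_linear U V X (f : X -> U) (v : V) :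
  linear f -> linear (fun x => f x *t v).
Proof. by move=> fl; exact: (lin_comp ((tpair_bilin U V).1 v) fl). Qed.

Lemma tpairr_linear U V X (u : U) (f : X -> V) :
  linear f -> linear (fun x => u *t f x).
Proof. by move=> fl; exact: (lin_comp ((tpair_bilin U V).2 u) fl). Qed.

Variable C : lmodType k.

Lemma nth_upd n (c : n.-tuple C) (i : 'I_n) x j :
  (upd c i x)`_j = if j == i then x else c`_j.
Proof.
case: (ltnP j n) => [jn|nj].
  by rewrite -[j]/(val (Ordinal jn)) -!(tnth_nth 0) tnth_mktuple.
rewrite !nth_default ?size_tuple //; case: eqP => // ji.
by move: nj; rewrite ji leqNgt ltn_ord.
Qed.

Lemma tseq_tuple n (c : n.-tuple C) : tseq n c = tpure c.
Proof.
by congr tpure; apply: eq_from_tnth => j; rewrite tnth_mktuple (tnth_nth 0).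
Qed.

Lemma tseq_linear n X (s : X -> seq C) (f : X -> C) (j : nat) :
  (j < n)%N -> linear f -> (forall x, (s x)`_j = f x) ->
  (forall x i, i != j -> (s x)`_i = (s 0)`_i) ->
  linear (fun x => tseq n (s x)).
Proof.
move=> jn fl sj si; pose c := [tuple (s 0)`_i | i < n].
have E x : tseq n (s x) = tpure (upd c (Ordinal jn) (f x)).
  rewrite -tseq_tuple; congr tpure; apply: eq_from_tnth => i.
  rewrite !tnth_mktuple nth_upd /=; case: eqP => [->|/eqP ij]; first exact: sj.
  by rewrite si // (nth_map i) ?size_enum_ord // nth_ord_enum.
move=> a x y; rewrite !E; move: a x y.
exact: (lin_comp (tpure_multilin c (Ordinal jn)) fl).
Qed.

Lemma nth_rcons_behead n (c : n.+1.-tuple C) y j :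
  (rcons (behead c) y)`_j =
    if (j < n)%N then c`_j.+1 else if j == n then y else 0.
Proof. by rewrite nth_rcons size_behead size_tuple /= nth_behead. Qed.

Lemma nth_insert (s : seq C) i x y j : (i < size s)%N ->
  (take i s ++ [:: x, y & drop i.+1 s])`_j =
    if (j < i)%N then s`_j else if j == i then x else
    if j == i.+1 then y else s`_j.-1.
Proof.
move=> si; rewrite nth_cat size_take si.
case: ltnP => [ji|]; first by rewrite nth_take.
move=> ij; have [->|ji] := eqVneq j i; first by rewrite subnn.
have {ji}ij : (i < j)%N by rewrite ltn_neqAle eq_sym ji.
case: j ij => // j; rewrite ltnS eqSS => ij; rewrite subSn //=.
have [->|ji] := eqVneq j i; first by rewrite subnn.
have {ji}ij : (i < j)%N by rewrite ltn_neqAle eq_sym ji.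
by rewrite -(subnSK ij) /= nth_drop subnKC.
Qed.

Lemma nth_remove (s : seq C) i j : (i.+1 < size s)%N ->
  (take i.+1 s ++ drop i.+2 s)`_j = if (j <= i)%N then s`_j else s`_j.+1.
Proof.
move=> si; rewrite nth_cat size_take si ltnS; case: leqP => ij.
  by rewrite nth_take.
by rewrite nth_drop addSn subnKC.
Qed.

End Multilinearity.

HB.mixin Record isCoalgebra (k : fieldType) C of GRing.Lmodule k C := {
  comul : {linear C -> tensor C C};
  counit : {scalar C};
  coassoc : forall c : C,
    \sw_(a, b <- comul c) \sw_(a1, a2 <- comul a) a1 *t (a2 *t b) =
    \sw_(a, b <- comul c) \sw_(b1, b2 <- comul b) a *t (b1 *t b2);
  counitl : forall c : C, \sw_(a, b <- comul c) counit a *: b = c;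
  counitr : forall c : C, \sw_(a, b <- comul c) counit b *: a = c
}.

#[short(type="coalgType")]
HB.structure Definition Coalgebra (k : fieldType) :=
  {C of GRing.Lmodule k C & isCoalgebra k C}.

HB.mixin Record isBialgebra (k : fieldType) H
    of GRing.Algebra k H & Coalgebra k H := {
  comul1 : comul (1 : H) = (1 : H) *t (1 : H);
  comulM : forall g h : H, comul (g * h) =
    \sw_(g1, g2 <- comul g) \sw_(h1, h2 <- comul h) (g1 * h1) *t (g2 * h2);
  counit1 : counit (1 : H) = 1 :> k;
  counitM : forall g h : H, counit (g * h) = counit g * counit h :> k
}.

#[short(type="bialgType")]
HB.structure Definition Bialgebra (k : fieldType) :=
  {H of GRing.Algebra k H & Coalgebra k H & isBialgebra k H}.

HB.mixin Record isHopf (k : fieldType) H of Bialgebra k H := {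
  antipode : {linear H -> H};
  antipodel : forall h : H,
    \sw_(h1, h2 <- comul h) antipode h1 * h2 = (counit h : k) *: 1;
  antipoder : forall h : H,
    \sw_(h1, h2 <- comul h) h1 * antipode h2 = (counit h : k) *: 1
}.

#[short(type="hopfAlgType")]
HB.structure Definition HopfAlgebra (k : fieldType) :=
  {H of Bialgebra k H & isHopf k H}.

HB.mixin Record isRightModule (k : fieldType) (H : hopfAlgType k) M
    of GRing.Lmodule k M := {
  ract : M -> H -> M;
  ract_bilin : bilin ract;
  ract1 : forall m : M, ract m 1 = m;
  ractM : forall (m : M) (g h : H), ract m (g * h) = ract (ract m g) h
}.

HB.mixin Record isLeftComodule (k : fieldType) (H : hopfAlgType k) M
    of GRing.Lmodule k M := {
  coact : {linear M -> tensor H M};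
  coact_coassoc : forall m : M,
    \sw_(a, n <- coact m) \sw_(a1, a2 <- comul a) a1 *t (a2 *t n) =
    \sw_(a, n <- coact m) \sw_(b, p <- coact n) a *t (b *t p);
  coact_counit : forall m : M, \sw_(a, n <- coact m) counit a *: n = m
}.

#[short(type="modComodType")]
HB.structure Definition ModComod (k : fieldType) (H : hopfAlgType k) :=
  {M of GRing.Lmodule k M & isRightModule k H M & isLeftComodule k H M}.

HB.mixin Record isModCoalgebra (k : fieldType) (H : hopfAlgType k) C
    of Coalgebra k C := {
  lact : H -> C -> C;
  lact_bilin : bilin lact;
  lact1 : forall c : C, lact 1 c = c;
  lactM : forall (g h : H) (c : C), lact (g * h) c = lact g (lact h c);
  comul_lact : forall (h : H) (c : C), comul (lact h c) =
    \sw_(h1, h2 <- comul h) \sw_(c1, c2 <- comul c) lact h1 c1 *t lact h2 c2;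
  counit_lact : forall (h : H) (c : C),
    counit (lact h c) = counit h * counit c :> k
}.

#[short(type="modCoalgType")]
HB.structure Definition ModCoalgebra (k : fieldType) (H : hopfAlgType k) :=
  {C of Coalgebra k C & isModCoalgebra k H C}.

Definition anti_yetter_drinfeld (k : fieldType) (H : hopfAlgType k)
    (M : modComodType H) : Prop :=
  forall (m : M) (h : H), coact (ract m h) =
    \sw_(h1, h' <- comul h) \sw_(h2, h3 <- comul h') \sw_(a, n <- coact m)
      (antipode h3 * a * h1) *t ract n h2.

Definition stable (k : fieldType) (H : hopfAlgType k) (M : modComodType H) :
    Prop :=
  forall m : M, \sw_(a, n <- coact m) ract n a = m.

Section IteratedCoproduct.
Variables (k : fieldType) (C : coalgType k).

(* c^(1) *t ... *t c^(n+1) *)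
Fixpoint comul_iter (n : nat) (c : C) : tpow C n.+1 :=
  if n isn't p.+1 then tseq 1 [:: c] else
  \sw_(a, b <- comul c) \swn_(d <- comul_iter p b) tseq p.+2 (a :: d).

Lemma comul_iter_linear n : linear (comul_iter n).
Proof.
elim: n => [|n IH].
  by apply: (@tseq_linear _ _ _ _ _ id 0) => // x [].
have cm a : multilin (fun d : n.+1.-tuple C => tseq n.+2 (a :: d)).
  move=> c i; apply: (@tseq_linear _ _ _ _ _ id i.+1) => // [|x|x [|j] nj //].
  - by rewrite ltnS.
  - by apply: (etrans (nth_upd c i x i)); rewrite eqxx.
  - apply: (etrans (nth_upd c i x j)); apply/esym/(etrans (nth_upd c i 0 j)).
    by rewrite (negPf (nj : j != i)).
have fb : bilin (fun a b : C => \swn_(d <- comul_iter n b) tseq n.+2 (a :: d)).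
  split=> [b|a]; last exact: (lin_comp (tpow_lift_linear (cm a)) IH).
  apply: tpow_lift_fun_linear => d.
  by apply: (@tseq_linear _ _ _ _ _ id 0) => // x [].
by apply: (lin_comp (tensor_lift_linear fb)); exact: linearP.
Qed.

End IteratedCoproduct.

Section CyclicMaps.
Variables (k : fieldType) (H : hopfAlgType k).
Variables (M : modComodType H) (C : modCoalgType H).
Implicit Types (n i : nat).

Definition lact_diag n (h : H) (x : tpow C n.+1) : tpow C n.+1 :=
  \swn_(g <- comul_iter n h) \swn_(c <- x)
    tpure [tuple lact (tnth g j) (tnth c j) | j < n.+1].

(* The cyc_raw maps are defined before passing to the quotient cyc_mod. *)
Definition cyc_raw n := tensor M (tpow C n.+1).

(* M (x)_H C^(x)(n+1) is the quotient of M (x) C^(x)(n+1) by the submodule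
   spanned by the m h (x) x - m (x) h x *)
Inductive balanced_rel n : cyc_raw n -> Prop :=
| BalancedRel m h x : balanced_rel (ract m h *t x - m *t lact_diag h x).

Definition cyc_mod n : Type := modq (@balanced_rel n).
HB.instance Definition _ n := GRing.Lmodule.on (cyc_mod n).

Definition cyc_proj n : {linear cyc_raw n -> cyc_mod n} :=
  modpi (@balanced_rel n).

Definition cyc_tau n (x : cyc_raw n) : cyc_raw n :=
  \sw_(m, y <- x) \swn_(c <- y) \sw_(a, m0 <- coact m)
    m0 *t tseq n.+1 (rcons (behead c) (lact a (thead c))).

(* delta_i : C^n -> C^(n+1), 0 <= i <= n+1; the last face is i = n+1 *)
Definition cyc_delta n i (x : cyc_raw n) : cyc_raw n.+1 :=
  if (i <= n)%N then
    \sw_(m, y <- x) \swn_(c <- y) \sw_(c1, c2 <- comul c`_i)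
      m *t tseq n.+2 (take i c ++ [:: c1, c2 & drop i.+1 c])
  else
    \sw_(m, y <- x) \swn_(c <- y)
      \sw_(a, m0 <- coact m) \sw_(c1, c2 <- comul (thead c))
      m0 *t tseq n.+2 (c2 :: rcons (behead c) (lact a c1)).

(* sigma_i : C^(n+1) -> C^n, 0 <= i <= n *)
Definition cyc_sigma n i (x : cyc_raw n.+1) : cyc_raw n :=
  \sw_(m, y <- x) \swn_(c <- y)
    m *t (counit c`_i.+1 *: tseq n.+1 (take i.+1 c ++ drop i.+2 c)).

Definition induces n p (f : cyc_raw n -> cyc_raw p)
    (g : cyc_mod n -> cyc_mod p) : Prop :=
  forall x, g (cyc_proj n x) = cyc_proj p (f x).

Definition descends n p (f : cyc_raw n -> cyc_raw p) : Prop :=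
  exists g : {linear cyc_mod n -> cyc_mod p}, induces f g.

End CyclicMaps.

(* only d n i with i <= n.+1 and s n i with i <= n matter *)
Record cocyclic (k : fieldType) (X : nat -> lmodType k)
    (d : forall n, nat -> {linear X n -> X n.+1})
    (s : forall n, nat -> {linear X n.+1 -> X n})
    (t : forall n, {linear X n -> X n}) : Prop := {
  coface_coface : forall n i j (x : X n), (i < j <= n.+2)%N ->
    d n.+1 j (d n i x) = d n.+1 i (d n j.-1 x);
  codeg_codeg : forall n i j (x : X n.+2), (i <= j <= n)%N ->
    s n j (s n.+1 i x) = s n i (s n.+1 j.+1 x);
  codeg_coface_lt : forall n i j (x : X n.+1), (i < j <= n.+1)%N ->
    s n.+1 j (d n.+1 i x) = d n i (s n j.-1 x);
  codeg_coface_id : forall n i j (x : X n), (j <= n)%N ->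
    (i == j) || (i == j.+1) -> s n j (d n i x) = x;
  codeg_coface_gt : forall n i j (x : X n.+1), (j.+1 < i <= n.+2)%N ->
    s n.+1 j (d n.+1 i x) = d n i.-1 (s n j x);
  cyclic_coface : forall n i (x : X n), (0 < i <= n.+1)%N ->
    t n.+1 (d n i x) = d n i.-1 (t n x);
  cyclic_coface0 : forall n (x : X n), t n.+1 (d n 0 x) = d n n.+1 x;
  cyclic_codeg : forall n i (x : X n.+1), (0 < i <= n)%N ->
    t n (s n i x) = s n i.-1 (t n.+1 x);
  cyclic_codeg0 : forall n (x : X n.+1),
    t n (s n 0 x) = s n n (t n.+1 (t n.+1 x));
  cyclic_iter : forall n (x : X n), iter n.+1 (t n) x = x
}.

Section CyclicMapsOnPureTensors.
Variables (k : fieldType) (H : hopfAlgType k).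
Variables (M : modComodType H) (C : modCoalgType H).

Lemma lact_linearl (c : C) : linear (fun h : H => lact h c).
Proof. by case: (@lact_bilin k H C). Qed.

Lemma lact_linearr (h : H) : linear (lact h : C -> C).
Proof. by case: (@lact_bilin k H C). Qed.

Lemma rcons_behead_linear n (X : lmodType k) (c : n.+1.-tuple C) (f : X -> C) :
  linear f -> linear (fun x => tseq n.+1 (rcons (behead c) (f x))).
Proof.
move=> fl; apply: (@tseq_linear _ _ _ _ _ f n) => // [x|x i ni].
  by rewrite nth_rcons_behead ltnn eqxx.
by rewrite !nth_rcons_behead (negPf ni).
Qed.

Lemma rotate_multilin n (h : H) : multilin (fun c : n.+1.-tuple C =>
  tseq n.+1 (rcons (behead c) (lact h (thead c)))).
Proof.
move=> c i; case: (eqVneq (i : nat) 0%N) => i0.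
  apply: (@tseq_linear _ _ _ _ _ (lact h) n) => // [|x|x j nj].
  - exact: lact_linearr.
  - by rewrite nth_rcons_behead ltnn eqxx /thead (tnth_nth 0) nth_upd /= i0.
  - by rewrite !nth_rcons_behead (negPf nj) !nth_upd i0.
have ilt : (i.-1 < n)%N by rewrite prednK ?lt0n // -ltnS.
apply: (@tseq_linear _ _ _ _ _ id i.-1) => // [|x|x j nj].
- by apply: leq_trans ilt _.
- by rewrite nth_rcons_behead ilt prednK ?lt0n // nth_upd eqxx.
- rewrite !nth_rcons_behead /thead !(tnth_nth 0) !nth_upd /=.
  have Ei (p : nat) : (p == i :> nat) = (p == i.-1.+1) by rewrite prednK ?lt0n.
  by rewrite !Ei eqSS (negPf nj).
Qed.

Lemma cyc_tau_bilin n : bilin (fun (m : M) (y : tpow C n.+1) =>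
  \swn_(c <- y) \sw_(a, m0 <- coact m)
    m0 *t tseq n.+1 (rcons (behead c) (lact a (thead c)))).
Proof.
split=> [y|m].
  apply: tpow_lift_fun_linear => c.
  apply: (lin_comp (tensor_lift_linear _)); last exact: linearP.
  split=> [m0|a]; last exact: (tpair_bilin _ _).1.
  exact/tpairr_linear/rcons_behead_linear/lact_linearl.
apply: tpow_lift_linear => c i; apply: tensor_lift_fun_linear => a m0.
exact/tpairr_linear/rotate_multilin.
Qed.

Lemma cyc_tau_linear n : linear (@cyc_tau k H M C n).
Proof. exact/tensor_lift_linear/cyc_tau_bilin. Qed.

Lemma cyc_tau_pure n (m : M) (c : n.+1.-tuple C) :
  cyc_tau (m *t tpure c) = \sw_(a, m0 <- coact m)
    m0 *t tseq n.+1 (rcons (behead c) (lact a (thead c))).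
Proof.
rewrite /cyc_tau tensor_lift_pair; last exact: cyc_tau_bilin.
rewrite tpow_lift_pure // => {}c i; apply: tensor_lift_fun_linear => a m0.
exact/tpairr_linear/rotate_multilin.
Qed.

Lemma insert_bilin n i (c : n.+1.-tuple C) : (i <= n)%N ->
  bilin (fun c1 c2 => tseq n.+2 (take i c ++ [:: c1, c2 & drop i.+1 c])).
Proof.
move=> ile; split=> c0.
  apply: (@tseq_linear _ _ _ _ _ id i) => // [|x|x j nj].
  - by rewrite ltnS; apply: leq_trans ile _.
  - by rewrite nth_insert ?size_tuple // ltnn eqxx.
  - by rewrite !nth_insert ?size_tuple // (negPf nj).
apply: (@tseq_linear _ _ _ _ _ id i.+1) => // [x|x j nj].
- by rewrite nth_insert ?size_tuple // ltnNge leqnSn /= gtn_eqF // eqxx.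
- by rewrite !nth_insert ?size_tuple // (negPf nj).
Qed.

Lemma delta_multilin n i (m : M) : (i <= n)%N ->
  multilin (fun c : n.+1.-tuple C => \sw_(c1, c2 <- comul c`_i)
    m *t tseq n.+2 (take i c ++ [:: c1, c2 & drop i.+1 c])).
Proof.
move=> ile c j; case: (eqVneq (j : nat) i) => ji.
  pose F (c1 c2 : C) := m *t tseq n.+2 (take i c ++ [:: c1, c2 & drop i.+1 c]).
  have Fb : bilin F.
    by split=> c0; apply: tpairr_linear;
       [exact: (insert_bilin c ile).1|exact: (insert_bilin c ile).2].
  have E x : tensor_lift (fun c1 c2 => m *t tseq n.+2
      (take i (upd c j x) ++ [:: c1, c2 & drop i.+1 (upd c j x)]))
      (comul (upd c j x)`_i) = tensor_lift F (comul x).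
    rewrite nth_upd ji eqxx; congr tensor_lift.
    apply/funext => c1; apply/funext => c2; congr (m *t tpure _).
    apply: eq_from_tnth => p; rewrite !tnth_mktuple !nth_insert ?size_tuple //.
    rewrite !nth_upd ji; case: ltngtP => // ip.
    case: (eqVneq (p : nat) i.+1) => // pi.
    by rewrite -eqSS (ltn_predK ip) (negPf pi).
  move=> a x y; rewrite !E; move: a x y.
  by apply: (lin_comp (tensor_lift_linear Fb)); exact: linearP.
have E x : (upd c j x)`_i = c`_i by rewrite nth_upd eq_sym (negPf ji).
have L : forall c1 c2, linear (fun x => m *t tseq n.+2
    (take i (upd c j x) ++ [:: c1, c2 & drop i.+1 (upd c j x)])).
  move=> c1 c2; apply: tpairr_linear.
  apply: (@tseq_linear _ _ _ _ _ id (bump i j)) => // [|x|x p np].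
  - rewrite /bump; case: (i <= j)%N => /=; first by rewrite add1n ltnS ltn_ord.
    by rewrite add0n ltnS ltnW // ltn_ord.
  - rewrite nth_insert ?size_tuple // /bump.
    case: (ltngtP i j) ji => // ij _; last by rewrite add0n ij nth_upd eqxx.
    by rewrite add1n ltnNge ltnW ?gtn_eqF ?eqSS ?gtn_eqF ?nth_upd ?eqxx // ltnW.
  - rewrite !nth_insert ?size_tuple // !nth_upd; move: np; rewrite /bump.
    case: (ltngtP i j) ji => // ij _; rewrite ?add1n ?add0n => np.
      have -> : (p.-1 == j) = false.
        by case: p np => [_|p]; [rewrite ltn_eqF // (leq_ltn_trans _ ij)|rewrite eqSS => /negPf].
      by case: ltngtP => // pi; rewrite ltn_eqF // (ltn_trans pi).
    rewrite (negPf np); case: ltngtP => // pi; case: eqP => // /eqP pi1.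
    by rewrite gtn_eqF //; case: (p) pi => // q; rewrite ltnS /= => /(leq_trans _) ->.
move=> a x y; rewrite !E; move: a x y.
exact: tensor_lift_fun_linear.
Qed.

Lemma cyc_delta_bilin n i : (i <= n)%N ->
  bilin (fun (m : M) (y : tpow C n.+1) =>
    \swn_(c <- y) \sw_(c1, c2 <- comul c`_i)
      m *t tseq n.+2 (take i c ++ [:: c1, c2 & drop i.+1 c])).
Proof.
move=> ile; split=> [y|m]; last exact/tpow_lift_linear/delta_multilin.
apply: tpow_lift_fun_linear => c; apply: tensor_lift_fun_linear => c1 c2.
exact: (tpair_bilin _ _).1.
Qed.

Lemma cyc_delta_pure n i (m : M) (c : n.+1.-tuple C) : (i <= n)%N ->
  cyc_delta i (m *t tpure c) = \sw_(c1, c2 <- comul c`_i)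
    m *t tseq n.+2 (take i c ++ [:: c1, c2 & drop i.+1 c]).
Proof.
move=> ile; rewrite /cyc_delta ile tensor_lift_pair.
  by rewrite tpow_lift_pure //; exact: delta_multilin.
exact: cyc_delta_bilin.
Qed.

Lemma delta_last_bilin n (m : M) (h : H) (c : n.+1.-tuple C) :
  bilin (fun c1 c2 => m *t tseq n.+2 (c2 :: rcons (behead c) (lact h c1))).
Proof.
split=> c0; apply: tpairr_linear.
  apply: (@tseq_linear _ _ _ _ _ (lact h) n.+1) => // [|x|x j nj].
  - exact: lact_linearr.
  - by rewrite /= nth_rcons_behead ltnn eqxx.
  - by case: j nj => // j nj; rewrite /= !nth_rcons_behead (negPf (nj : j != n)).
by apply: (@tseq_linear _ _ _ _ _ id 0) => // x [].
Qed.

Lemma delta_last_multilin n (m : M) (h : H) :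
  multilin (fun c : n.+1.-tuple C => \sw_(c1, c2 <- comul (thead c))
    m *t tseq n.+2 (c2 :: rcons (behead c) (lact h c1))).
Proof.
move=> c i; case: (eqVneq (i : nat) 0%N) => i0.
  have E x : tensor_lift (fun c1 c2 => m *t tseq n.+2
      (c2 :: rcons (behead (upd c i x)) (lact h c1))) (comul (thead (upd c i x)))
    = tensor_lift (fun c1 c2 => m *t tseq n.+2
      (c2 :: rcons (behead c) (lact h c1))) (comul x).
    rewrite /thead (tnth_nth 0) nth_upd i0 /=; congr tensor_lift.
    apply/funext => c1; apply/funext => c2; congr (m *t tpure _).
    apply: eq_from_tnth => -[[|p] pn]; rewrite !tnth_mktuple //.
    apply: (etrans (nth_rcons_behead (upd c i x) (lact h c1) p)).
    rewrite nth_upd i0; exact: (esym (nth_rcons_behead c (lact h c1) p)).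
  move=> a x y; rewrite !E; move: a x y.
  by apply: (lin_comp (tensor_lift_linear (delta_last_bilin _ _ _)));
     exact: linearP.
have E x : thead (upd c i x) = thead c.
  by rewrite /thead !(tnth_nth 0) nth_upd eq_sym (negPf i0).
have L : forall c1 c2, linear (fun x => m *t tseq n.+2
    (c2 :: rcons (behead (upd c i x)) (lact h c1))).
  move=> c1 c2; apply: tpairr_linear.
  have ilt : (i.-1 < n)%N by rewrite prednK ?lt0n // -ltnS.
  apply: (@tseq_linear _ _ _ _ _ id i) => // [|x|x p np].
  - by rewrite ltnW // ltnS.
  - have ei : i = i.-1.+1 :> nat by rewrite prednK ?lt0n.
    rewrite ei; apply: (etrans (nth_rcons_behead _ _ i.-1)).
    by rewrite ilt -ei nth_upd eqxx.
  - case: p np => [|p] np //; apply: (etrans (nth_rcons_behead _ _ p)).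
    apply/esym/(etrans (nth_rcons_behead _ _ p)).
    by rewrite !nth_upd (negPf np).
move=> a x y; rewrite !E; move: a x y.
exact: tensor_lift_fun_linear.
Qed.

Lemma cyc_delta_last_bilin n :
  bilin (fun (m : M) (y : tpow C n.+1) => \swn_(c <- y)
      \sw_(a, m0 <- coact m) \sw_(c1, c2 <- comul (thead c))
      m0 *t tseq n.+2 (c2 :: rcons (behead c) (lact a c1))).
Proof.
split=> [y|m].
  apply: tpow_lift_fun_linear => c.
  apply: (lin_comp (tensor_lift_linear _)); last exact: linearP.
  split=> [m0|a]; apply: tensor_lift_fun_linear => c1 c2;
    last exact: (tpair_bilin _ _).1.
  apply: tpairr_linear.
  apply: (@tseq_linear _ _ _ _ _ (lact^~ c1) n.+1) => // [|x|x j nj].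
  - exact: lact_linearl.
  - by rewrite /= nth_rcons_behead ltnn eqxx.
  - by case: j nj => // j nj; rewrite /= !nth_rcons_behead (negPf (nj : j != n)).
apply: tpow_lift_linear => c i; apply: tensor_lift_fun_linear => a m0.
exact: delta_last_multilin.
Qed.

Lemma cyc_delta_last_pure n i (m : M) (c : n.+1.-tuple C) : (n < i)%N ->
  cyc_delta i (m *t tpure c) =
    \sw_(a, m0 <- coact m) \sw_(c1, c2 <- comul (thead c))
      m0 *t tseq n.+2 (c2 :: rcons (behead c) (lact a c1)).
Proof.
rewrite ltnNge => /negPf ni; rewrite /cyc_delta ni tensor_lift_pair.
  rewrite tpow_lift_pure // => {}c j; apply: tensor_lift_fun_linear => a m0.
  exact: delta_last_multilin.
exact: cyc_delta_last_bilin.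
Qed.

Lemma cyc_delta_linear n i : linear (@cyc_delta k H M C n i).
Proof.
move=> a x y; rewrite /cyc_delta; case: ifP => ile; move: a x y;
  apply: tensor_lift_linear.
  exact: cyc_delta_bilin.
exact: cyc_delta_last_bilin.
Qed.

Lemma sigma_multilin n i : (i <= n)%N ->
  multilin (fun c : n.+2.-tuple C =>
    (counit c`_i.+1 : k) *: tseq n.+1 (take i.+1 c ++ drop i.+2 c)).
Proof.
move=> ile c j; case: (eqVneq (j : nat) i.+1) => ji.
  have E x : tseq n.+1 (take i.+1 (upd c j x) ++ drop i.+2 (upd c j x)) =
             tseq n.+1 (take i.+1 c ++ drop i.+2 c).
    congr tpure; apply: eq_from_tnth => p; rewrite !tnth_mktuple.
    rewrite !nth_remove ?size_tuple // !nth_upd ji eqSS.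
    by case: leqP => pi; [rewrite ltn_eqF|rewrite gtn_eqF].
  move=> a x y; rewrite !E !nth_upd ji eqxx linearP scalerDl scalerA.
  by [].
have L : linear (fun x => tseq n.+1
    (take i.+1 (upd c j x) ++ drop i.+2 (upd c j x))).
  apply: (@tseq_linear _ _ _ _ _ id (unbump i.+1 j)) => // [|x|x p].
  - rewrite /unbump; case: (ltnP i.+1 j) => ij; rewrite ?subn1 ?subn0.
      by rewrite (ltn_predK ij) -ltnS ltn_ord.
    by rewrite (@leq_trans i.+1) // ltn_neqAle ji ij.
  - rewrite nth_remove ?size_tuple // !nth_upd /unbump.
    case: (ltngtP i.+1 j) ji => // ij _; rewrite ?subn1 ?subn0.
      by rewrite leqNgt -ltnS (ltn_predK ij) ij eqxx.
    by rewrite -ltnS ij eqxx.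
  - rewrite !nth_remove ?size_tuple // !nth_upd /unbump.
    case: (ltngtP i.+1 j) ji => // ij _; rewrite ?subn1 ?subn0 => pj.
      have -> : (p.+1 == j) = (p == j.-1) by rewrite -[RHS]eqSS (ltn_predK ij).
      rewrite (negPf pj); case: (leqP p i) => // pi.
      by rewrite ltn_eqF // (leq_ltn_trans pi) // ltnW.
    rewrite (negPf pj); case: (leqP p i) => // pi.
    by rewrite gtn_eqF // (leq_trans ij) // ltnW.
move=> a x y; rewrite !nth_upd [_ == _ :> nat]eq_sym (negPf ji) L.
by rewrite scalerDr !scalerA mulrC.
Qed.

Lemma cyc_sigma_bilin n i : (i <= n)%N ->
  bilin (fun (m : M) (y : tpow C n.+2) => \swn_(c <- y)
    m *t (counit c`_i.+1 *: tseq n.+1 (take i.+1 c ++ drop i.+2 c))).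
Proof.
move=> ile; split=> [y|m].
  apply: tpow_lift_fun_linear => c; exact: (tpair_bilin _ _).1.
apply: tpow_lift_linear => c j; apply: tpairr_linear.
exact: sigma_multilin.
Qed.

Lemma cyc_sigma_linear n i : (i <= n)%N -> linear (@cyc_sigma k H M C n i).
Proof. by move=> ile; exact/tensor_lift_linear/cyc_sigma_bilin. Qed.

Lemma cyc_sigma_pure n i (m : M) (c : n.+2.-tuple C) : (i <= n)%N ->
  cyc_sigma i (m *t tpure c) =
    m *t (counit c`_i.+1 *: tseq n.+1 (take i.+1 c ++ drop i.+2 c)).
Proof.
move=> ile; rewrite /cyc_sigma tensor_lift_pair; last exact: cyc_sigma_bilin.
by rewrite tpow_lift_pure // => {}c j; apply: tpairr_linear; exact: sigma_multilin.
Qed.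

Lemma lact_diag_multilinl n (c : n.+1.-tuple C) :
  multilin (fun g : n.+1.-tuple H =>
    tpure [tuple lact (tnth g j) (tnth c j) | j < n.+1]).
Proof.
move=> g i a x y.
have E z : [tuple lact (tnth (upd g i z) j) (tnth c j) | j < n.+1] =
    upd [tuple lact (tnth g j) (tnth c j) | j < n.+1] i (lact z (tnth c i)).
  apply: eq_from_tnth => j; rewrite !tnth_mktuple; by case: eqP => // ->.
by rewrite !E lact_linearl tpure_multilin.
Qed.

Lemma lact_diag_multilinr n (g : n.+1.-tuple H) :
  multilin (fun c : n.+1.-tuple C =>
    tpure [tuple lact (tnth g j) (tnth c j) | j < n.+1]).
Proof.
move=> c i a x y.
have E z : [tuple lact (tnth g j) (tnth (upd c i z) j) | j < n.+1] =
    upd [tuple lact (tnth g j) (tnth c j) | j < n.+1] i (lact (tnth g i) z).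
  apply: eq_from_tnth => j; rewrite !tnth_mktuple; by case: eqP => // ->.
by rewrite !E lact_linearr tpure_multilin.
Qed.

Lemma lact_diag_linear n (h : H) :
  linear (lact_diag h : tpow C n.+1 -> tpow C n.+1).
Proof.
move=> a x y; move: a x y; apply: tpow_lift_fun_linear => g.
exact/tpow_lift_linear/lact_diag_multilinr.
Qed.

Lemma lact_diag_pure n (h : H) (c : n.+1.-tuple C) :
  lact_diag h (tpure c) = \swn_(g <- comul_iter n h)
    tpure [tuple lact (tnth g j) (tnth c j) | j < n.+1].
Proof.
congr tpow_lift; apply/funext => g.
exact/tpow_lift_pure/lact_diag_multilinr.
Qed.

End CyclicMapsOnPureTensors.

Arguments cyc_tau {k H} M C n x.
Arguments cyc_delta {k H} M C n i x.
Arguments cyc_sigma {k H} M C n i x.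

(* Main.v *)
(** The map tau_n only sees its first tensor factor through the coaction, so
  balancedness of tau_1 on C = H, evaluated at m h (x) 1 (x) 1, is an identity
  in M (x)_H (H (x) H); transported along the isomorphism
  m (x) g (x) h |-> S(g2) h (x) m g1 with H (x) M it is precisely the
  anti-Yetter-Drinfeld condition.  Conversely that condition moves h past the
  coaction at the price of a factor S(h3), which the diagonal action then
  cancels.  For the cocyclic structure, the last coface is tau delta_0, so the
  identities involving it follow from those of the inner cofaces; all of these
  hold before passing to the quotient, except tau_n^(n+1) = id.  The latter
  holds since tau_n^(n+1) sends m (x) c to m0 (x) m_(-1) c, which is equal to
  m0 m_(-1) (x) c in the quotient, and so to m (x) c by stability. *)

From HB Require Import structures.
Require Import Defs.
From mathcomp Require Import all_boot all_order all_algebra.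
From mathcomp Require Import boolp zify.

Set Implicit Arguments.
Unset Strict Implicit.
Unset Printing Implicit Defensive.

Import GRing.Theory.

Local Open Scope ring_scope.

(** * Sweedler calculus *)

Section Sweedler.
Variable k : fieldType.
Implicit Types U V W X : lmodType k.

Lemma linear_id U : linear (fun x : U => x).
Proof. by []. Qed.

Lemma linear_zero U V (f : U -> V) : linear f -> f 0 = 0.
Proof.
by move=> fl; have := fl (-1) 0 0; rewrite scaler0 addr0 scaleN1r addNr.
Qed.

Lemma linear_scale U V (f : U -> V) a x : linear f -> f (a *: x) = a *: f x.
Proof. by move=> fl; have := fl a x 0; rewrite (linear_zero fl) !addr0. Qed.

Lemma scale_linear U V (a : k) (f : U -> V) :
  linear f -> linear (fun x => a *: f x).
Proof. by move=> fl b x y; rewrite fl scalerDr !scalerA mulrC. Qed.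

Lemma sw_linear X U V W (F : U -> V -> W) (f : X -> tensor U V) :
  bilin F -> linear f -> linear (fun x => \sw_(a, b <- f x) F a b).
Proof. by move=> Fb; apply/lin_comp/tensor_lift_linear. Qed.

Lemma sw_pair U V W (F : U -> V -> W) u v :
  bilin F -> \sw_(a, b <- u *t v) F a b = F u v.
Proof. by move=> Fb; rewrite tensor_lift_pair. Qed.

Lemma sw_map U V W X (L : W -> X) (F : U -> V -> W) (x : tensor U V) :
  linear L -> bilin F ->
  L (\sw_(a, b <- x) F a b) = \sw_(a, b <- x) L (F a b).
Proof.
move=> Ll Fb.
have LFb : bilin (fun a b => L (F a b)).
  by split=> [v|u]; apply: (lin_comp Ll); [apply: Fb.1|apply: Fb.2].
apply: (tensor_ext (f := fun x => L (tensor_lift F x))).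
- exact/(lin_comp Ll)/tensor_lift_linear.
- exact: tensor_lift_linear.
by move=> u v; rewrite !sw_pair.
Qed.

Lemma sw_ext U V W (F G : U -> V -> W) (x : tensor U V) :
  (forall a b, F a b = G a b) -> \sw_(a, b <- x) F a b = \sw_(a, b <- x) G a b.
Proof.
by move=> FG; congr tensor_lift; apply/funext => a; apply/funext => b.
Qed.

(** Both sides are linear in [x], so [x] may be taken to be a pure tensor, where its sum
    disappears. *)
Lemma sw_exchange U V U' V' W (F : U -> V -> U' -> V' -> W)
    (x : tensor U V) (y : tensor U' V') :
  (forall c d, bilin (fun a b => F a b c d)) ->
  (forall a b, bilin (F a b)) ->
  \sw_(a, b <- x) \sw_(c, d <- y) F a b c d =
  \sw_(c, d <- y) \sw_(a, b <- x) F a b c d.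
Proof.
move=> Fab Fcd.
pose G a b := \sw_(c, d <- y) F a b c d.
have Gb : bilin G.
  by split=> z; apply: tensor_lift_fun_linear => c d;
     [exact: (Fab c d).1|exact: (Fab c d).2].
apply: (tensor_ext (f := tensor_lift G)
  (g := fun x => \sw_(c, d <- y) \sw_(a, b <- x) F a b c d)).
- exact: tensor_lift_linear.
- by apply: tensor_lift_fun_linear => c d; apply: tensor_lift_linear.
by move=> a b; rewrite sw_pair //; apply: sw_ext => c d; rewrite sw_pair.
Qed.

Definition trilin U V U' W (F : U -> V -> U' -> W) : Prop :=
  [/\ forall v w, linear (fun u => F u v w),
      forall u w, linear (fun v => F u v w) &
      forall u v, linear (fun w => F u v w)].

Lemma sw_trilin_bilin U V U' W (F : U -> V -> U' -> W) : trilin F ->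
  bilin (fun a x => \sw_(b, c <- x) F a b c).
Proof.
case=> F1 F2 F3; split=> [x|a]; first by apply: tensor_lift_fun_linear.
apply: tensor_lift_linear; split=> z; [exact: F2|exact: F3].
Qed.

Lemma sw_trilin U V U' W (F : U -> V -> U' -> W) u v w : trilin F ->
  \sw_(a, x <- u *t (v *t w)) \sw_(b, c <- x) F a b c = F u v w.
Proof.
move=> Ft; rewrite sw_pair; last exact: sw_trilin_bilin.
by case: Ft => F1 F2 F3; rewrite sw_pair.
Qed.

(** Coassociativity in a form that covers the coproduct ([A = B = C]) as well as the coaction
    ([A = H], [B = M]). A trilinear [F] factors through the linear map [L] on triple tensors, and
    [L] is applied to the given identity. *)
Lemma sw_assoc U V U' W (A B : lmodType k) (F : U -> V -> U' -> W)
    (f : A -> tensor U V) (g : B -> tensor V U')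
    (x : tensor A U') (y : tensor U B) :
  linear f -> linear g -> trilin F ->
  \sw_(a, w <- x) \sw_(u, v <- f a) u *t (v *t w) =
  \sw_(u, b <- y) \sw_(v, w <- g b) u *t (v *t w) ->
  \sw_(a, w <- x) \sw_(u, v <- f a) F u v w =
  \sw_(u, b <- y) \sw_(v, w <- g b) F u v w.
Proof.
move=> fl gl Ft eq_xy.
pose L z := \sw_(a, x <- z) \sw_(b, c <- x) F a b c.
have Ll : linear L by apply/tensor_lift_linear/sw_trilin_bilin.
have LE u v w : L (u *t (v *t w)) = F u v w by apply: sw_trilin.
have P1 (w : U') : bilin (fun (u : U) (v : V) => u *t (v *t w)).
  split=> z; first exact: tpairl_linear.
  by apply: tpairr_linear; apply: tpairl_linear.
have P2 (u : U) : bilin (fun (v : V) (w : U') => u *t (v *t w)).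
  by split=> z; apply: tpairr_linear;
     [apply: tpairl_linear|apply: tpairr_linear].
transitivity (L (\sw_(a, w <- x) \sw_(u, v <- f a) u *t (v *t w))).
  rewrite sw_map //.
    apply: sw_ext => a w; rewrite sw_map //.
    by apply: sw_ext => u v; rewrite LE.
  split=> [w|a]; first by apply: sw_linear.
  apply: tensor_lift_fun_linear => u v.
  by apply: tpairr_linear; apply: tpairr_linear.
rewrite eq_xy sw_map //.
  by apply: sw_ext => u b; rewrite sw_map //; apply: sw_ext => v w; rewrite LE.
split=> [b|u]; last by apply: sw_linear.
by apply: tensor_lift_fun_linear => v w; apply: tpairl_linear.
Qed.

End Sweedler.

(** * Coassociativity and counit rules under a Sweedler sum *)

Section Coalgebra.
Variables (k : fieldType) (C : coalgType k) (W : lmodType k).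

Lemma sw_coassoc (F : C -> C -> C -> W) (c : C) : trilin F ->
  \sw_(a, b <- comul c) \sw_(a1, a2 <- comul a) F a1 a2 b =
  \sw_(a, b <- comul c) \sw_(b1, b2 <- comul b) F a b1 b2.
Proof.
by move=> Ft; apply: sw_assoc; [exact: linearP..|exact: Ft|exact: coassoc].
Qed.

Lemma counit_scale_linear (X Y : lmodType k) (f : X -> C) (w : Y) :
  linear f -> linear (fun x => (counit (f x) : k) *: w).
Proof. by move=> fl a x y; rewrite fl linearP scalerDl scalerA. Qed.

Lemma sw_counitl (f : C -> W) (c : C) : linear f ->
  \sw_(a, b <- comul c) (counit a : k) *: f b = f c.
Proof.
move=> fl; rewrite -[in RHS](counitl c) sw_map //.
  by apply: sw_ext => a b; rewrite linear_scale.
split=> [v|u]; first exact: (counit_scale_linear (f := id)).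
exact: scale_linear.
Qed.

Lemma sw_counitr (f : C -> W) (c : C) : linear f ->
  \sw_(a, b <- comul c) (counit b : k) *: f a = f c.
Proof.
move=> fl; rewrite -[in RHS](counitr c) sw_map //.
  by apply: sw_ext => a b; rewrite linear_scale.
split=> [v|u]; first exact: scale_linear.
exact: (counit_scale_linear (f := id)).
Qed.

End Coalgebra.

(** * The diagonal action on lists of factors *)

Section Multilinear.
Variables (k : fieldType) (C W : lmodType k).

(** Multilinearity at all lengths at once. Since no length is recorded, fixing a prefix or a suffix
    preserves the property, which the inductions on lists rely on. *)
Definition mlin (F : seq C -> W) : Prop :=
  forall s t, linear (fun x => F (s ++ x :: t)).

Lemma mlin_catl (F : seq C -> W) s : mlin F -> mlin (fun d => F (s ++ d)).
Proof. by move=> Fm u v a x y; rewrite !catA Fm. Qed.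

Lemma mlin_catr (F : seq C -> W) t : mlin F -> mlin (fun d => F (d ++ t)).
Proof. by move=> Fm u v a x y; rewrite -!catA Fm. Qed.

Lemma mlin_linear (X : lmodType k) (F : seq C -> W) (f : X -> C) t :
  mlin F -> linear f -> linear (fun x => F (f x :: t)).
Proof. by move=> Fm fl; exact: (lin_comp (Fm [::] t) fl). Qed.

End Multilinear.

Lemma mull_linear (k : fieldType) (A : algType k) (a : A) :
  linear (fun x : A => x * a).
Proof. by move=> b x y; rewrite mulrDl scalerAl. Qed.

Lemma mulr_linear (k : fieldType) (A : algType k) (a : A) :
  linear (fun x : A => a * x).
Proof. by move=> b x y; rewrite mulrDr scalerAr. Qed.

Section DiagonalAction.
Variables (k : fieldType) (H : hopfAlgType k) (C : modCoalgType H).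

(* dact h [:: c_0; ...; c_n] F is F (h^(1) c_0, ..., h^(n+1) c_n); passing the
   continuation F instead of a tensor power avoids all casts between lengths *)
Fixpoint dact (W : lmodType k) (h : H) (s : seq C) (F : seq C -> W) : W :=
  if s is x :: t then
    \sw_(h1, h2 <- comul h) dact h2 t (fun d => F (lact h1 x :: d))
  else (counit h : k) *: F [::].

Lemma dact_fun_linear (X W : lmodType k) (h : H) s (F : X -> seq C -> W) :
  (forall d, linear (F^~ d)) -> linear (fun x => dact h s (F x)).
Proof.
elim: s h F => [|y s IH] h F Fl /=; first exact: scale_linear.
by apply: tensor_lift_fun_linear => h1 h2; apply: IH => d.
Qed.

Lemma dact_linear (W : lmodType k) s (F : seq C -> W) :
  mlin F -> linear (fun h => dact h s F).
Proof.
elim: s F => [|y s IH] F Fm /=.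
  exact: (counit_scale_linear (f := fun x => x)).
apply: (sw_linear (f := comul)); last exact: linearP.
split=> [h2|h1].
  apply: dact_fun_linear => d.
  by apply: (mlin_linear d Fm); exact: lact_linearl.
by apply: IH => u v; apply: (Fm (_ :: u)).
Qed.

Lemma dact_comp_linear (X W : lmodType k) s (F : seq C -> W) (f : X -> H) :
  mlin F -> linear f -> linear (fun x => dact (f x) s F).
Proof. by move=> Fm fl; exact: (lin_comp (dact_linear s Fm) fl). Qed.

Lemma dact_mlin (W : lmodType k) h (F : seq C -> W) :
  mlin F -> mlin (fun s => dact h s F).
Proof.
move=> Fm s t; elim: s h F Fm => [|y s IH] h F Fm /=.
  apply: tensor_lift_fun_linear => h1 h2; apply: dact_fun_linear => d.
  by apply: (mlin_linear d Fm); exact: lact_linearr.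
apply: tensor_lift_fun_linear => h1 h2; apply: IH.
exact: (mlin_catl [:: lact h1 y] Fm).
Qed.

(** The diagonal action preserves length, so the continuation only ever sees lists as long as
    [s]. *)
Lemma dact_ext (W : lmodType k) h s (F G : seq C -> W) :
  (forall d, size d = size s -> F d = G d) -> dact h s F = dact h s G.
Proof.
elim: s h F G => [|y s IH] h F G FG /=; first by rewrite FG.
by apply: sw_ext => h1 h2; apply: IH => d ds; rewrite FG //= ds.
Qed.

End DiagonalAction.

(* lin proves multilinearity of a Sweedler expression by following its syntax;
   lin_seq Fm g treats F (g x), where g is built from cons and cat *)
Ltac lin_seq Fm g :=
  lazymatch g with
  | (fun x => cons (@?f x) (@?g1 x)) =>
      lazymatch g1 with
      | (fun _ => ?t) => refine (mlin_linear (f := f) t Fm _)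
      | _ => lazymatch f with (fun _ => ?c) =>
               lin_seq constr:(mlin_catl [:: c] Fm) g1 end
      end
  | (fun x => cat (@?g1 x) (@?g2 x)) =>
      lazymatch g2 with
      | (fun _ => ?t) => lin_seq constr:(mlin_catr t Fm) g1
      | _ => lazymatch g1 with (fun _ => ?t) =>
               lin_seq constr:(mlin_catl t Fm) g2 end
      end
  end.

Ltac lin :=
  cbv beta;
  lazymatch goal with
  | |- forall _, _ => move=> ?; lin
  | |- trilin _ => split=> ? ?; lin
  | |- bilin _ => split=> ?; lin
  | |- mlin (fun d => _) => move=> ? ?; lin
  | |- mlin _ => solve [auto]
  | |- GRing.linear_for _ (GRing.Linear.sort _) => exact: linearP
  | |- GRing.linear_for _ (fun x => x) => exact: linear_id
  | |- GRing.linear_for _ (fun x => tensor_lift (@?f x) (@?g x)) =>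
      lazymatch g with
      | (fun _ => ?v) => apply: tensor_lift_fun_linear => ? ?; lin
      | _ => lazymatch f with (fun _ => ?v) => apply: sw_linear; lin end
      end
  | |- GRing.linear_for _ (fun x => dact (@?h x) (@?s x) (@?f x)) =>
      lazymatch s with
      | (fun _ => ?s0) =>
          lazymatch h with
          | (fun _ => ?h0) =>
              refine (@dact_fun_linear _ _ _ _ _ h0 s0 f _) => ?; lin
          | _ => refine (@dact_comp_linear _ _ _ _ _ s0 _ h _ _); lin
          end
      | _ =>
          lazymatch h with (fun _ => ?h0) =>
            lazymatch f with (fun _ => ?F) =>
              let Fm := fresh in have Fm : mlin F; [lin|];
              lin_seq constr:(dact_mlin h0 Fm) s; lin
            end
          end
      end
  | |- GRing.linear_for _ (fun x => tpair (@?f x) (@?g x)) =>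
      lazymatch g with
      | (fun _ => ?v) => refine (@tpairl_linear _ _ _ _ f v _); lin
      | _ => lazymatch f with (fun _ => ?v) =>
               refine (@tpairr_linear _ _ _ _ v g _); lin end
      end
  | |- GRing.linear_for _ (fun x => lact (@?f x) (@?g x)) =>
      lazymatch g with
      | (fun _ => ?v) =>
          refine (lin_comp (@lact_linearl _ _ _ v) (g := f) _); lin
      | _ => lazymatch f with (fun _ => ?v) =>
               refine (lin_comp (@lact_linearr _ _ _ v) (g := g) _); lin end
      end
  | |- GRing.linear_for _ (fun x => ract (@?f x) (@?g x)) =>
      lazymatch g with
      | (fun _ => ?v) =>
          refine (lin_comp ((@ract_bilin _ _ _).1 v) (g := f) _); lin
      | _ => lazymatch f with (fun _ => ?v) =>
               refine (lin_comp ((@ract_bilin _ _ _).2 v) (g := g) _); lin end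
      end
  | |- GRing.linear_for _ (fun x => GRing.mul (@?f x) (@?g x)) =>
      lazymatch g with
      | (fun _ => ?v) => refine (lin_comp (mull_linear v) (g := f) _); lin
      | _ => lazymatch f with (fun _ => ?v) =>
               refine (lin_comp (mulr_linear v) (g := g) _); lin end
      end
  | |- GRing.linear_for _ (fun x => GRing.scale (@?f x) (@?g x)) =>
      lazymatch g with
      | (fun _ => ?v) => apply: counit_scale_linear; lin
      | _ => lazymatch f with (fun _ => ?v) =>
               refine (@scale_linear _ _ _ v g _); lin end
      end
  | |- GRing.linear_for _ (fun x => GRing.Linear.sort ?g (@?f x)) =>
      refine (lin_comp (linearP g) (g := f) _); lin
  | |- GRing.linear_for _ (fun x => ?F (@?g x)) =>
      first
        [ let Fm := fresh in have Fm : mlin F; [by auto|]; lin_seq Fm g; lin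
        | solve [auto] ]
  | |- _ => solve [auto]
  end.

(** * Compatibility of the diagonal action with coproduct, counit and coaction *)

Section DiagonalActionTheory.
Variables (k : fieldType) (H : hopfAlgType k) (C : modCoalgType H).
Implicit Types (U V W X : lmodType k) (s t : seq C).

Lemma dact_map W X (L : W -> X) h s (F : seq C -> W) :
  linear L -> mlin F -> dact h s (fun d => L (F d)) = L (dact h s F).
Proof.
move=> Ll; elim: s h F => [|y s IH] h F Fm /=.
  exact/esym/linear_scale.
rewrite sw_map //; last by lin.
by apply: sw_ext => h1 h2; rewrite -IH //; lin.
Qed.

(** Coassociativity allows the last leg of [h] to be split off instead of the first, which is what
    [tau_n] calls for, as it appends at the end. For empty [s] both sides reduce to [F
    [:: lact h x]] by the counit rules. *)
Lemma dact_cat1 W h s x (F : seq C -> W) : mlin F ->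
  dact h (s ++ [:: x]) F =
  \sw_(h1, h2 <- comul h) dact h1 s (fun d => F (d ++ [:: lact h2 x])).
Proof.
elim: s h F => [|y s IH] h F Fm /=.
  rewrite (sw_counitl (f := fun h => F [:: lact h x])); last by lin.
  by rewrite (sw_counitr (f := fun h => F [:: lact h x])); last lin.
rewrite (sw_coassoc (F := fun a b c =>
  dact b s (fun d => F (lact a y :: d ++ [:: lact c x])))); last by lin.
by apply: sw_ext => h1 h2; rewrite IH //; lin.
Qed.

Lemma dact_sw W U V h s (F : U -> V -> seq C -> W) (x : tensor U V) :
  (forall d, bilin (fun a b => F a b d)) -> (forall a b, mlin (F a b)) ->
  dact h s (fun d => \sw_(a, b <- x) F a b d) =
  \sw_(a, b <- x) dact h s (F a b).
Proof.
move=> Fb Fm; elim: s h F Fb Fm => [|y s IH] h F Fb Fm /=.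
  by rewrite (sw_map (L := fun z => (counit h : k) *: z)) //; lin.
rewrite (sw_exchange (F := fun a b h1 h2 =>
  dact h2 s (fun d => F a b (lact h1 y :: d)))) => [|h1 h2|a b]; last by lin.
  by apply: sw_ext => h1 h2; rewrite IH // => a b; lin.
by split=> z; apply: dact_fun_linear => d; [apply: (Fb _).1|apply: (Fb _).2].
Qed.

Lemma sw_comul_lact W (F : C -> C -> W) h x : bilin F ->
  \sw_(c1, c2 <- comul (lact h x)) F c1 c2 =
  \sw_(h1, h2 <- comul h) \sw_(c1, c2 <- comul x) F (lact h1 c1) (lact h2 c2).
Proof.
move=> Fb; rewrite comul_lact.
have Fl := tensor_lift_linear Fb.
rewrite (sw_map _ Fl); last by lin.
apply: sw_ext => h1 h2; rewrite (sw_map _ Fl); last by lin.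
by apply: sw_ext => c1 c2; rewrite sw_pair.
Qed.

(** This is why the inner cofaces descend. Induction on the prefix reduces to comultiplying the
    first factor; there Delta(h1 x) is the product of Delta(h1) and Delta(x), and coassociativity
    regroups the legs of [h]. [G] is prescribed only at the lengths that occur, because the cofaces
    are computed only there. *)
Lemma dact_comul W h s x t (F G : seq C -> W) : mlin F ->
  (forall s' y t', size s' = size s -> size t' = size t ->
     G (s' ++ y :: t') = \sw_(c1, c2 <- comul y) F (s' ++ [:: c1, c2 & t'])) ->
  dact h (s ++ x :: t) G =
  \sw_(c1, c2 <- comul x) dact h (s ++ [:: c1, c2 & t]) F.
Proof.
elim: s h F G => [|y s IH] h F G Fm GE /=; last first.
  rewrite (sw_exchange (F := fun c1 c2 h1 h2 => dact h2 (s ++ [:: c1, c2 & t])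
    (fun d => F (lact h1 y :: d)))); [|by lin..].
  apply: sw_ext => h1 h2; apply: IH; first by lin.
  by move=> s' z t' ss tt; rewrite (GE (_ :: s')) //= ss.
transitivity (\sw_(h1, h2 <- comul h) \sw_(k1, k2 <- comul h1)
    \sw_(c1, c2 <- comul x)
      dact h2 t (fun d => F [:: lact k1 c1, lact k2 c2 & d])).
  apply: sw_ext => h1 h2.
  rewrite (dact_ext _ _ (G := fun d => \sw_(k1, k2 <- comul h1)
    \sw_(c1, c2 <- comul x) F [:: lact k1 c1, lact k2 c2 & d])); last first.
    by move=> d ds; rewrite (GE [::]) // sw_comul_lact //; lin.
  rewrite dact_sw; [|by lin..].
  by apply: sw_ext => k1 k2; rewrite dact_sw //; lin.
rewrite (sw_coassoc (F := fun a b c => \sw_(c1, c2 <- comul x)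
  dact c t (fun d => F [:: lact a c1, lact b c2 & d]))); last by lin.
rewrite (sw_exchange (F := fun c1 c2 h1 h2 => \sw_(k1, k2 <- comul h2)
  dact k2 t (fun d => F [:: lact h1 c1, lact k1 c2 & d]))); [|by lin..].
apply: sw_ext => h1 h2.
by rewrite (sw_exchange (F := fun c1 c2 k1 k2 =>
  dact k2 t (fun d => F [:: lact h1 c1, lact k1 c2 & d]))); [|by lin..].
Qed.

(** The counterpart for codegeneracies: eps(h1 x) = eps(h1) eps(x), and the counit rule absorbs
    eps(h1). *)
Lemma dact_counit W h s x t (F G : seq C -> W) : mlin F ->
  (forall s' y t', size s' = size s -> size t' = size t ->
     G (s' ++ y :: t') = (counit y : k) *: F (s' ++ t')) ->
  dact h (s ++ x :: t) G = (counit x : k) *: dact h (s ++ t) F.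
Proof.
elim: s h F G => [|y s IH] h F G Fm GE /=; last first.
  rewrite (sw_map (L := fun z => (counit x : k) *: z)); [|by lin..].
  apply: sw_ext => h1 h2; apply: IH; first by lin.
  by move=> s' z t' ss tt; rewrite (GE (_ :: s')) //= ss.
rewrite -(sw_counitl (f := fun h => (counit x : k) *: dact h t F)); last by lin.
apply: sw_ext => h1 h2.
rewrite (dact_ext _ _
  (G := fun d => (counit h1 : k) *: ((counit x : k) *: F d))).
  rewrite (dact_map (L := fun z => (counit h1 : k) *: z)); [|by lin..].
  by rewrite (dact_map (L := fun z => (counit x : k) *: z)) //; lin.
by move=> d ds; rewrite (GE [::]) // counit_lact scalerA.
Qed.

(* m^(-n-1), ..., m^(-1) acting on c_0, ..., c_n; this describes tau^(n+1) *)
Fixpoint cdact (M : modComodType H) W (m : M) s (F : M -> seq C -> W) : W :=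
  if s is x :: t then
    \sw_(a, n <- coact m) cdact n t (fun p d => F p (lact a x :: d))
  else F m [::].

(** Coassociativity of the coaction trades repeated coactions for a single one followed by
    coproducts of its [H]-leg. The empty list is the counit rule of the coaction. *)
Lemma cdact_dact (M : modComodType H) W (m : M) s (F : M -> seq C -> W) :
  (forall m, mlin (F m)) -> (forall s, linear (F^~ s)) ->
  cdact m s F = \sw_(a, n <- coact m) dact a s (F n).
Proof.
elim: s m F => [|x s IH] m F Fm Fl /=.
  rewrite -[in LHS](coact_counit m) (sw_map (L := F^~ [::])); [|by lin..].
  by apply: sw_ext => a n; exact: (linear_scale _ _ (Fl [::])).
rewrite (sw_assoc (F := fun a b n => dact b s (fun d => F n (lact a x :: d)))
  (g := coact) (y := coact m)).
- by apply: sw_ext => a n; rewrite IH //; lin.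
- exact: linearP.
- exact: linearP.
- by lin.
exact: coact_coassoc.
Qed.

End DiagonalActionTheory.

(** * The cyclic maps on lists of factors *)

Section TensorList.
Variables (k : fieldType) (C : lmodType k).

(* the value 0 on lists of the wrong length makes tlist n multilinear on all
   lists, so that mlin needs no side condition on lengths *)
Definition tlist n (s : seq C) : tpow C n :=
  if size s == n then tseq n s else 0.

Lemma tlist_pure n (c : n.-tuple C) : tlist n c = tpure c.
Proof. by rewrite /tlist size_tuple eqxx tseq_tuple. Qed.

Lemma tlist_tseq n s : size s = n -> tlist n s = tseq n s.
Proof. by rewrite /tlist => ->; rewrite eqxx. Qed.

Lemma tlist_size n s : size s != n -> tlist n s = 0.
Proof. by rewrite /tlist => /negPf->. Qed.

Lemma tlist_mlin n : mlin (tlist n).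
Proof.
move=> s t; have [sz|sz] := eqVneq (size s + size t).+1 n; last first.
  have E x : tlist n (s ++ x :: t) = 0.
    by rewrite tlist_size // size_cat /= addnS.
  by move=> a x y; rewrite !E scaler0 addr0.
have E x : tlist n (s ++ x :: t) = tseq n (s ++ x :: t).
  by rewrite tlist_tseq // size_cat /= addnS.
move=> a x y; rewrite !E; move: a x y.
apply: (@tseq_linear _ _ _ _ _ id (size s)) => // [|x|x i ni].
- by rewrite -sz ltnS leq_addr.
- by rewrite nth_cat ltnn subnn.
- rewrite !nth_cat; case: ltnP => // si.
  case E' : (i - size s)%N => [|p] //=; case/eqP: ni.
  by apply/eqP; rewrite eqn_leq si -subn_eq0 E'.
Qed.

Lemma val_upd n (c : n.-tuple C) (i : 'I_n) x :
  upd c i x = take i c ++ x :: drop i.+1 c :> seq C.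
Proof.
have si : size (take i c) = i by rewrite size_take size_tuple ltn_ord.
apply: (@eq_from_nth _ 0) => [|j].
  rewrite size_cat /= si size_drop !size_tuple subnSK //.
  by rewrite subnKC ?card_ord // ltnW.
move=> _; rewrite nth_upd nth_cat si; case: ltngtP => // ij.
- by rewrite nth_take.
- by rewrite -(subnSK ij) /= nth_drop subnKC.
by rewrite ij subnn.
Qed.

Lemma mlin_multilin (W : lmodType k) n (F : seq C -> W) :
  mlin F -> multilin (fun c : n.-tuple C => F c).
Proof. by move=> Fm c i a x y; rewrite !val_upd Fm. Qed.

Lemma tpow_lift_tlist (W : lmodType k) n (F : seq C -> W) s :
  mlin F -> size s = n -> \swn_(c <- tlist n s) F c = F s.
Proof.
move=> Fm /eqP sn; rewrite -[s]/(val (Tuple sn)) tlist_pure tpow_lift_pure //.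
exact: mlin_multilin.
Qed.

Lemma tpow_list_ext (W : lmodType k) n (f g : tpow C n -> W) :
  linear f -> linear g ->
  (forall s, size s = n -> f (tlist n s) = g (tlist n s)) -> f =1 g.
Proof.
move=> fl gl fg; apply: tpow_ext => // c; rewrite -tlist_pure.
by apply: fg; rewrite size_tuple.
Qed.

Lemma tpow_map (W X : lmodType k) n (L : W -> X) (F : seq C -> W)
    (x : tpow C n) : linear L -> mlin F ->
  L (\swn_(c <- x) F c) = \swn_(c <- x) L (F c).
Proof.
move=> Ll Fm.
have LFm : mlin (fun s => L (F s)) by move=> u v; apply: (lin_comp Ll).
apply: (tpow_list_ext
  (f := fun x => L (tpow_lift (fun c : n.-tuple C => F c) x))
  (g := tpow_lift (fun c : n.-tuple C => L (F c)))).
- exact/(lin_comp Ll)/tpow_lift_linear/mlin_multilin.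
- exact/tpow_lift_linear/(mlin_multilin LFm).
by move=> s sn; rewrite tpow_lift_tlist // (tpow_lift_tlist LFm).
Qed.

End TensorList.

(** * Tuples replaced by lists, and the quotient over [H] *)

Section Maps.
Variables (k : fieldType) (H : hopfAlgType k).
Variables (M : modComodType H) (C : modCoalgType H).

(* as for tlist, the value 0 at lists of different lengths makes zact s
   multilinear in g *)
Fixpoint zact (W : lmodType k) (s : seq C) (g : seq H) (F : seq C -> W) : W :=
  match s, g with
  | [::], [::] => F [::]
  | x :: s', h :: g' => zact s' g' (fun d => F (lact h x :: d))
  | _, _ => 0
  end.

Lemma zact_fun_linear (X W : lmodType k) s g (F : X -> seq C -> W) :
  (forall d, linear (F^~ d)) -> linear (fun x => zact s g (F x)).
Proof.
have lin0 : linear (fun _ : X => 0 : W) by move=> a x y; rewrite scaler0 addr0.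
elim: s g F => [|y s IH] [|h g] F Fl //=.
by apply: IH => d.
Qed.

Lemma zact_mlin (W : lmodType k) s (F : seq C -> W) :
  mlin F -> mlin (fun g => zact s g F).
Proof.
have lin0 : linear (fun _ : H => 0 : W) by move=> a x y; rewrite scaler0 addr0.
move=> Fm u v; elim: s u F Fm => [|y s IH] [|h u] F Fm //=.
  by apply: zact_fun_linear; lin.
by apply: IH; lin.
Qed.

(** Links the iterated coproduct with [dact]: both split off the leftmost leg, and the counit that
    ends [dact] is absorbed once a single factor is left. *)
Lemma zact_dact (W : lmodType k) n h s (F : seq C -> W) :
  mlin F -> size s = n.+1 ->
  \swn_(g <- comul_iter n h) zact s g F = dact h s F.
Proof.
elim: n h s F => [|n IH] h [|x s] F Fm //= [sn].
  case: s sn => // _; rewrite -tlist_tseq //.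
  rewrite (tpow_lift_tlist (zact_mlin [:: x] Fm)) //=.
  by rewrite (sw_counitr (f := fun h => F [:: lact h x])) //; lin.
have zm := zact_mlin (x :: s) Fm.
have zm' a : mlin (fun d : seq H => tlist n.+2 (a :: d)).
  exact: (mlin_catl [:: a] (tlist_mlin _)).
rewrite (sw_map (L := tpow_lift (fun g : n.+2.-tuple H => zact (x :: s) g F))).
- apply: sw_ext => h1 h2; rewrite -IH //; last by lin.
  (* [tseq] is traded for [tlist] under the binder, because [tlist] is multilinear on lists of every
     length. *)
  transitivity (tpow_lift (fun g : n.+2.-tuple H => zact (x :: s) g F)
    (\swn_(d <- comul_iter n h2) tlist n.+2 (h1 :: d))).
    congr tpow_lift; congr tpow_lift; apply/funext => d.
    by rewrite tlist_tseq //= size_tuple.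
  rewrite (tpow_map (F := fun d => tlist n.+2 (h1 :: d))) //; last first.
    exact/tpow_lift_linear/(mlin_multilin zm).
  congr tpow_lift; apply/funext => d.
  by rewrite (tpow_lift_tlist zm) //= size_tuple.
- exact/tpow_lift_linear/(mlin_multilin zm).
have E a (d : n.+1.-tuple H) : tseq n.+2 (a :: d) = tlist n.+2 (a :: d).
  by rewrite tlist_tseq //= size_tuple.
split=> z.
  apply: tpow_lift_fun_linear => d a x' y'; rewrite !E.
  exact: (tlist_mlin n.+2 [::] d).
apply: lin_comp; last exact: comul_iter_linear.
apply: tpow_lift_linear => c i a x' y'; rewrite !E.
exact: (mlin_multilin (zm' z)).
Qed.

Lemma zact_tuple (W : lmodType k) n (c : n.-tuple C) (g : n.-tuple H)
    (F : seq C -> W) :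
  zact c g F = F [tuple lact (tnth g j) (tnth c j) | j < n].
Proof.
elim: n c g F => [|n IH] c g F.
  by rewrite (tuple0 c) (tuple0 g) /=; congr F; rewrite enum_ord0.
case/tupleP: c => x c; case/tupleP: g => h g /=; rewrite IH; congr F.
rewrite /= enum_ordSl /= !tnth0; congr cons.
rewrite -map_comp; apply: eq_map => j /=.
by rewrite !tnthS.
Qed.

Lemma lact_diag_tlist n (h : H) (s : seq C) : size s = n.+1 ->
  lact_diag (C := C) h (tlist n.+1 s) = dact h s (tlist n.+1).
Proof.
move=> /[dup] sn /eqP sn'; rewrite -(zact_dact h (tlist_mlin _) sn).
rewrite -[s]/(val (Tuple sn')) tlist_pure lact_diag_pure.
by congr tpow_lift; apply/funext => g; rewrite zact_tuple tlist_pure.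
Qed.

Lemma cyc_raw_ext (W : lmodType k) n (f g : cyc_raw M C n -> W) :
  linear f -> linear g ->
  (forall m s, size s = n.+1 ->
     f (m *t tlist n.+1 s) = g (m *t tlist n.+1 s)) ->
  f =1 g.
Proof.
move=> fl gl fg; apply: tensor_ext => // m x.
move: x; apply: tpow_list_ext => [||s]; last exact: fg.
  by apply: (lin_comp fl); apply: tpairr_linear.
by apply: (lin_comp gl); apply: tpairr_linear.
Qed.

(** Through [tlist] this is zero on lists of the wrong length, hence multilinear on all lists. These
    classes span the quotient. *)
Definition cyc_pure n (m : M) (s : seq C) : cyc_mod M C n :=
  cyc_proj M C n (m *t tlist n.+1 s).

Lemma cyc_pure_linear n s : linear (fun m => cyc_pure n m s).
Proof. by apply: lin_comp; [exact: linearP|exact: tpairl_linear]. Qed.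

Lemma tpair_tlist_mlin n (m : M) : mlin (fun s : seq C => m *t tlist n s).
Proof. by move=> s t; apply: tpairr_linear; exact: tlist_mlin. Qed.

Lemma cyc_pure_mlin n m : mlin (cyc_pure n m).
Proof.
by move=> s t; apply: lin_comp; [exact: linearP|exact: tpair_tlist_mlin].
Qed.

Lemma cyc_pure_ract n m h s : size s = n.+1 ->
  cyc_pure n (ract m h) s = dact h s (cyc_pure n m).
Proof.
move=> sn.
rewrite (dact_map (L := fun x => cyc_proj M C n (m *t x)));
  last exact: tlist_mlin.
  rewrite -lact_diag_tlist //; apply/eqP; rewrite -subr_eq0 -linearB /=.
  by apply/eqP/modpi_gen; exact: BalancedRel.
by apply: lin_comp; [exact: linearP|exact: tpairr_linear].
Qed.

Lemma cyc_mod_ext (W : lmodType k) n (f g : cyc_mod M C n -> W) :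
  linear f -> linear g ->
  (forall m s, size s = n.+1 -> f (cyc_pure n m s) = g (cyc_pure n m s)) ->
  f =1 g.
Proof.
move=> fl gl fg x; rewrite -[x]modreprK.
apply: (cyc_raw_ext (f := fun x => f (cyc_proj M C n x))
  (g := fun x => g (cyc_proj M C n x))).
- by apply: (lin_comp fl); exact: linearP.
- by apply: (lin_comp gl); exact: linearP.
exact: fg.
Qed.

(** Universal property of the quotient; by linearity the balancing relation is only asked for on
    pure tensors. *)
Lemma balanced_quotient (W : lmodType k) n (f : cyc_raw M C n -> W) :
  linear f ->
  (forall m h s, size s = n.+1 ->
     f (ract m h *t tlist n.+1 s) =
     dact h s (fun d => f (m *t tlist n.+1 d))) ->
  exists g : {linear cyc_mod M C n -> W}, forall x, g (cyc_proj M C n x) = f x.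
Proof.
move=> fl fb.
have fG x : @balanced_rel k H M C n x -> f x = 0.
  case=> m h y; have fB u v : f (u - v) = f u - f v.
    by have := fl (-1) v u; rewrite !scaleN1r [- v + _]addrC [- f v + _]addrC.
  apply/eqP; rewrite fB subr_eq0; apply/eqP.
  apply: (tpow_list_ext (f := fun y => f (ract m h *t y))
    (g := fun y => f (m *t lact_diag (C := C) h y))).
  - by apply: (lin_comp fl); exact: tpairr_linear.
  - by apply: (lin_comp fl); apply: tpairr_linear; exact: lact_diag_linear.
  move=> s sn; rewrite fb // lact_diag_tlist //.
  rewrite (dact_map (L := fun y => f (m *t y))) //; last exact: tlist_mlin.
  by apply: (lin_comp fl); exact: tpairr_linear.
(* The value of [f] at a chosen representative; the choice is immaterial since [f] kills the
   relations by [fG]. *)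
pose g (x : cyc_mod M C n) := f (modrepr x).
have gE x : g (cyc_proj M C n x) = f x by apply: modq_lift.
have gl : linear g.
  by move=> a x y; rewrite -[x]modreprK -[y]modreprK -linearP !gE fl.
by exists (HB.pack_for {linear cyc_mod M C n -> W} g
  (GRing.isLinear.Build k _ W *:%R g gl)).
Qed.

End Maps.

#[local] Hint Extern 0 (GRing.linear_for _ _) => exact: cyc_pure_linear : core.
#[local] Hint Extern 0 (mlin _) => exact: cyc_pure_mlin : core.
#[local] Hint Extern 0 (mlin _) => exact: tlist_mlin : core.

Lemma seq_split (T : Type) (s : seq T) i : (i < size s)%N ->
  exists s1 x s2, s = s1 ++ x :: s2 /\ size s1 = i.
Proof.
case: s => // x0 s is_; exists (take i (x0 :: s)), (nth x0 (x0 :: s) i).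
exists (drop i.+1 (x0 :: s)); split; last by rewrite size_takel // ltnW.
by rewrite -(drop_nth x0) // cat_take_drop.
Qed.

(** * Formulas for the cyclic maps on lists, and descent to the quotient *)

Section MapsOnLists.
Variables (k : fieldType) (H : hopfAlgType k).
Variables (M : modComodType H) (C : modCoalgType H).
Implicit Types (m : M) (s t : seq C).

Lemma cyc_tau_tlist n m x t : (size t).+1 = n.+1 ->
  cyc_tau M C n (m *t tlist n.+1 (x :: t)) =
  \sw_(a, p <- coact m) p *t tlist n.+1 (t ++ [:: lact a x]).
Proof.
move=> sz; have /eqP sz' : size (x :: t) = n.+1 by [].
rewrite -[x :: t]/(val (Tuple sz')) tlist_pure cyc_tau_pure.
apply: sw_ext => a p; rewrite tlist_tseq ?size_cat ?addn1 //=.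
by rewrite cats1 /thead (tnth_nth 0).
Qed.

Lemma cyc_delta_tlist n m s x t : (size s + size t)%N = n ->
  cyc_delta M C n (size s) (m *t tlist n.+1 (s ++ x :: t)) =
  \sw_(c1, c2 <- comul x) m *t tlist n.+2 (s ++ [:: c1, c2 & t]).
Proof.
move=> sz; have /eqP sz' : size (s ++ x :: t) = n.+1.
  by rewrite size_cat /= addnS sz.
rewrite -[s ++ x :: t]/(val (Tuple sz')) tlist_pure.
rewrite cyc_delta_pure /=; last first.
  by rewrite -sz leq_addr.
rewrite nth_cat ltnn subnn /=; apply: sw_ext => c1 c2.
rewrite take_size_cat // drop_cat ltnNge leqnSn /= subSnn /= drop0.
by rewrite tlist_tseq // size_cat /= !addnS sz.
Qed.

(** The last coface is tau delta_0 already before the quotient: once expanded, the two sides differ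
    by the order of the sums over the coaction and over the coproduct of the first factor. *)
Lemma cyc_delta_last n i (x : cyc_raw M C n) : (n < i)%N ->
  cyc_delta M C n i x = cyc_tau M C n.+1 (cyc_delta M C n 0 x).
Proof.
move=> ni; apply: (cyc_raw_ext (f := cyc_delta M C n i)
  (g := fun x => cyc_tau M C n.+1 (cyc_delta M C n 0 x)))
  => [||m [|y t] // [sz]].
- exact: cyc_delta_linear.
- by apply: lin_comp; [exact: cyc_tau_linear|exact: cyc_delta_linear].
have /eqP sz' : size (y :: t) = n.+1 by rewrite /= sz.
rewrite (cyc_delta_tlist m (s := [::])) //.
rewrite (sw_map (L := cyc_tau M C n.+1)); [|exact: cyc_tau_linear|by lin].
rewrite -[y :: t]/(val (Tuple sz')) tlist_pure cyc_delta_last_pure //.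
transitivity (\sw_(a, p <- coact m) \sw_(c1, c2 <- comul y)
    p *t tlist n.+2 (c2 :: t ++ [:: lact a c1])).
  apply: sw_ext => a p; apply: sw_ext => c1 c2.
  by rewrite cats1 tlist_tseq //= size_rcons sz.
rewrite sw_exchange; [|by lin..].
by apply: sw_ext => c1 c2; rewrite cyc_tau_tlist //= sz.
Qed.

(** Since sigma_i removes c_(i+1), the prefix before the removed factor has i+1 entries; hence the
    index [(size s).-1] and the nonempty prefix. *)
Lemma cyc_sigma_tlist n m s x t :
  (size s + size t)%N = n.+1 -> (0 < size s)%N ->
  cyc_sigma M C n (size s).-1 (m *t tlist n.+2 (s ++ x :: t)) =
  (counit x : k) *: (m *t tlist n.+1 (s ++ t)).
Proof.
move=> sz s0; have /eqP sz' : size (s ++ x :: t) = n.+2.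
  by rewrite size_cat /= addnS sz.
rewrite -[s ++ x :: t]/(val (Tuple sz')) tlist_pure.
rewrite cyc_sigma_pure /=; last first.
  by rewrite -ltnS prednK // -sz leq_addr.
rewrite prednK // nth_cat ltnn subnn /= take_size_cat //.
rewrite drop_cat ltnNge leqnSn /= subSnn /= drop0.
rewrite tlist_tseq ?size_cat //.
by apply: (linear_scale (f := fun y => m *t y)); exact: tpairr_linear.
Qed.

Lemma cyc_delta_descends n i : (i <= n)%N -> descends (cyc_delta M C n i).
Proof.
move=> ni; apply: balanced_quotient => [|m h s sn].
  by apply: lin_comp; [exact: linearP|exact: cyc_delta_linear].
have is_ : (i < size s)%N by rewrite sn ltnS.
have [s1 [x [s2 [sE s1i]]]] := seq_split is_.
have sz12 : (size s1 + size s2)%N = n.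
  by move: sn; rewrite sE size_cat /= addnS => -[].
rewrite {is_}sE {s sn} -{ni i}s1i cyc_delta_tlist //.
rewrite (sw_map (L := cyc_proj M C n.+1)); [|exact: linearP|by lin].
transitivity (\sw_(c1, c2 <- comul x)
    dact h (s1 ++ [:: c1, c2 & s2]) (cyc_pure n.+1 m)).
  apply: sw_ext => c1 c2; rewrite -cyc_pure_ract //.
  by rewrite size_cat /= !addnS sz12.
symmetry; apply: dact_comul => // s' y t' ss tt.
rewrite -ss cyc_delta_tlist; last by rewrite ss tt.
by rewrite (sw_map (L := cyc_proj M C n.+1)); [|exact: linearP|by lin].
Qed.

Lemma cyc_sigma_descends n i : (i <= n)%N -> descends (cyc_sigma M C n i).
Proof.
move=> ni; apply: balanced_quotient => [|m h s sn].
  by apply: lin_comp; [exact: linearP|exact: cyc_sigma_linear].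
have is_ : (i.+1 < size s)%N by rewrite sn !ltnS.
have [s1 [x [s2 [sE s1i]]]] := seq_split is_.
have sz12 : (size s1 + size s2)%N = n.+1.
  by move: sn; rewrite sE size_cat /= addnS => -[].
rewrite {is_}sE {s sn} -[i]/(i.+1.-1) -s1i cyc_sigma_tlist // ?s1i //.
rewrite (linear_scale _ _ (linearP (cyc_proj M C n))).
rewrite -/(cyc_pure n (ract m h) _) cyc_pure_ract ?size_cat //.
symmetry; apply: dact_counit => // s' y t' ss tt.
rewrite -s1i -ss cyc_sigma_tlist ?ss ?tt // ?s1i //.
exact: (linear_scale _ _ (linearP (cyc_proj M C n))).
Qed.

(** The anti-Yetter-Drinfeld condition turns tau of m h (x) x (x) t into m_0 h2 (x) t (x) S(h3)
    m_(-1) h1 x. When h2 moves across the tensor sign, its last leg meets S(h3) and the two cancel.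
    What remains is tau of m (x) h(x (x) t). *)
Lemma cyc_tau_descends n : anti_yetter_drinfeld M -> descends (cyc_tau M C n).
Proof.
move=> ayd; apply: balanced_quotient => [|m h [|x t] // [tn]].
  by apply: lin_comp; [exact: linearP|exact: cyc_tau_linear].
have tauE p y d : size d = n ->
    cyc_proj M C n (cyc_tau M C n (p *t tlist n.+1 (y :: d))) =
    \sw_(a, q <- coact p) cyc_pure n q (d ++ [:: lact a y]).
  move=> dn; rewrite cyc_tau_tlist ?dn //.
  by rewrite (sw_map (L := cyc_proj M C n)); [|exact: linearP|by lin].
rewrite tauE // ayd.
pose G (a : H) (p : M) := cyc_pure n p (t ++ [:: lact a x]).
have Gb : bilin G by rewrite /G; lin.
pose L := tensor_lift G.
have Ll : linear L by exact: tensor_lift_linear.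
(* [u] acts on the tail [t], and [b] collects what stands in front of [a * h1]: it is k2 S(h3)
   before the cancellation and 1 after it. *)
pose K (h1 u b : H) := \sw_(a, p <- coact m)
  dact u t (fun d => cyc_pure n p (d ++ [:: lact (b * a * h1) x])).
transitivity (\sw_(h1, h' <- comul h) K h1 h' 1).
  rewrite -/G -/L (sw_map _ Ll); last by lin.
  apply: sw_ext => h1 h'; rewrite (sw_map _ Ll); last by lin.
  transitivity (\sw_(h2, h3 <- comul h') \sw_(k1, k2 <- comul h2)
      K h1 k1 (k2 * antipode h3)).
    apply: sw_ext => h2 h3; rewrite (sw_map _ Ll); last by lin.
    rewrite /K sw_exchange; [|by lin..].
    apply: sw_ext => a p; rewrite /L sw_pair //.
    rewrite cyc_pure_ract ?size_cat ?addn1 ?tn // dact_cat1; last by lin.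
    by apply: sw_ext => k1 k2; rewrite -lactM !mulrA.
  rewrite (sw_coassoc (F := fun k1 k2 h3 => K h1 k1 (k2 * antipode h3)));
    last by rewrite /K; lin.
  rewrite -(sw_counitr (f := fun u => K h1 u 1)); last by rewrite /K; lin.
  apply: sw_ext => k1 l.
  (* Here k2 and h3 are the two legs of [l], so the antipode axiom leaves the counit of [l]. *)
  rewrite -(sw_map (L := K h1 k1) (F := fun k2 h3 => k2 * antipode h3)).
  - rewrite antipoder; apply: (linear_scale (f := K h1 k1)); rewrite /K; lin.
  - by rewrite /K; lin.
  - by lin.
(* On the other side [h1] acts on [x] first, and the rotation then carries the product [a * h1] to
   the end. *)
rewrite /=; apply: sw_ext => h1 h2; rewrite /K.
rewrite (dact_ext _ (G := fun d => \sw_(a, p <- coact m)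
  cyc_pure n p (d ++ [:: lact a (lact h1 x)]))).
  rewrite dact_sw; [|by lin..].
  apply: sw_ext => a p; apply: dact_ext => d _.
  by rewrite mul1r lactM.
by move=> d dt; rewrite tauE // dt.
Qed.

End MapsOnLists.

Lemma sw_tpair (k : fieldType) (U V : lmodType k) (x : tensor U V) :
  \sw_(a, b <- x) a *t b = x.
Proof.
apply: (tensor_ext (f := tensor_lift (@tpair k U V)) (g := id)) => // [|u v].
  exact/tensor_lift_linear/tpair_bilin.
by rewrite sw_pair //; exact: tpair_bilin.
Qed.

(** * Necessity of the anti-Yetter-Drinfeld condition *)

Section Regular.
Variables (k : fieldType) (H : hopfAlgType k).

Lemma antipode1 : antipode (1 : H) = 1.
Proof.
have := antipodel (1 : H).
rewrite comul1 sw_pair ?mulr1 ?counit1 ?scale1r //; lin.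
Qed.

(* a direct proof, which does not go through the antimultiplicativity of S *)
Lemma sw_antipode_mul (x g : H) :
  \sw_(x1, x2 <- comul x) antipode (x1 * g) * x2 =
  (counit x : k) *: antipode g.
Proof.
(* The convolution of [K] with the identity is u |-> eps(x u) 1, by the antipode axiom at x u.
   Convolving with S on the right then gives K(g) = eps(x) S(g). *)
pose K (u : H) := \sw_(x1, x2 <- comul x) antipode (x1 * u) * x2.
rewrite -/(K g) -(sw_counitr (f := K)); last by rewrite /K; lin.
transitivity (\sw_(g1, g2 <- comul g) \sw_(h1, h2 <- comul g2)
  K g1 * (h1 * antipode h2)).
  apply: sw_ext => g1 g2.
  rewrite -(sw_map (L := fun z => K g1 * z)
    (F := fun h1 h2 => h1 * antipode h2)); [|by lin..].
  by rewrite antipoder -scalerAr mulr1.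
rewrite -(sw_coassoc (F := fun g1 h1 h2 => K g1 * (h1 * antipode h2)));
  last by rewrite /K; lin.
rewrite -(sw_counitl (f := fun u => (counit x : k) *: antipode u)); last by lin.
apply: sw_ext => g1 g2.
transitivity ((\sw_(h1, h2 <- comul g1) K h1 * h2) * antipode g2).
  rewrite (sw_map (L := fun z => z * antipode g2));
    [|by lin|by rewrite /K; lin].
  by apply: sw_ext => h1 h2; rewrite mulrA.
suff -> : \sw_(h1, h2 <- comul g1) K h1 * h2 = (counit (x * g1) : k) *: 1.
  by rewrite counitM -scalerAl mul1r scalerA mulrC.
have Sb : bilin (fun a b : H => antipode a * b) by lin.
rewrite -antipodel comulM (sw_map _ (tensor_lift_linear Sb)); last by lin.
transitivity (\sw_(h1, h2 <- comul g1) \sw_(x1, x2 <- comul x)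
    antipode (x1 * h1) * (x2 * h2)).
  apply: sw_ext => h1 h2.
  rewrite /K (sw_map (L := fun z => z * h2)); [|by lin..].
  by apply: sw_ext => x1 x2; rewrite mulrA.
rewrite sw_exchange; [|by lin..].
apply: sw_ext => x1 x2; rewrite (sw_map _ (tensor_lift_linear Sb)); last by lin.
by apply: sw_ext => h1 h2; rewrite sw_pair.
Qed.

(** The test coalgebra, on which [H] will act by left multiplication; the alias gives this action a
    type of its own. *)
Definition regular : Type := H.
HB.instance Definition _ := Coalgebra.copy regular H.

Lemma regular_bilin : bilin (fun (h : H) (x : regular) => h * x : regular).
Proof. by split=> z; [exact: mull_linear|exact: mulr_linear]. Qed.

Lemma regular1 (x : regular) : (1 : H) * x = x.
Proof. exact: mul1r. Qed.

Lemma regularM (g h : H) (x : regular) : (g * h) * x = g * (h * x).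
Proof. by rewrite mulrA. Qed.

Lemma regular_comul (h : H) (x : regular) :
  comul (h * x : regular) =
  \sw_(h1, h2 <- comul h) \sw_(x1, x2 <- comul x)
    (h1 * x1 : regular) *t (h2 * x2 : regular).
Proof. exact: comulM. Qed.

Lemma regular_counit (h : H) (x : regular) :
  counit (h * x : regular) = counit h * counit x :> k.
Proof. exact: counitM. Qed.

HB.instance Definition _ := isModCoalgebra.Build k H regular
  regular_bilin regular1 regularM regular_comul regular_counit.

End Regular.

Section Necessity.
Variables (k : fieldType) (H : hopfAlgType k) (M : modComodType H).

(* induces the isomorphism from M (x)_H (H (x) H) to H (x) M *)
Definition untwist (m : M) (s : seq (regular H)) : tensor H M :=
  if s is [:: g; h] then
    \sw_(g1, g2 <- comul (g : H)) (antipode g2 * (h : H)) *t ract m g1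
  else 0.

Lemma untwist_mlin m : mlin (untwist m).
Proof.
have lin0 : linear (fun _ : regular H => 0 : tensor H M).
  by move=> a x y; rewrite scaler0 addr0.
case=> [|g [|h s]] t //=.
- case: t => [|h [|? ?]] //=.
  have Fb : bilin (fun g1 g2 : H => (antipode g2 * (h : H)) *t ract m g1).
    by lin.
  exact: (sw_linear Fb (linearP (@comul k H))).
- case: t => [|? ?] //=.
  have xl (g2 : H) : linear (fun x : H => antipode g2 * x) by lin.
  by apply: tensor_lift_fun_linear => g1 g2; apply: tpairl_linear; exact: xl.
- by case: s => [|? ?] /=.
Qed.

Lemma untwist_linear s : linear (fun m => untwist m s).
Proof.
have lin0 : linear (fun _ : M => 0 : tensor H M).
  by move=> a x y; rewrite scaler0 addr0.
by case: s => [|g [|h [|? ?]]] //=; lin.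
Qed.

(** The diagonal action of [x] produces S(x2 g2) x3 h (x) m x1 g1. By [sw_antipode_mul] the legs x2
    and x3 contract, which leaves S(g2) h (x) m x g1. *)
Lemma untwist_balanced m x s : size s = 2 ->
  untwist (ract m x) s = dact x s (untwist m).
Proof.
case: s => [|g [|h [|? ?]]] //= _.
transitivity (\sw_(x1, x2 <- comul x) \sw_(y1, y2 <- comul x1)
    \sw_(g1, g2 <- comul (g : H))
      (antipode (y2 * g2) * (x2 * (h : H))) *t ract m (y1 * g1)); last first.
  apply: sw_ext => x1 x2.
  have hl : linear (fun u : H => untwist m [:: lact x1 g; lact u h]).
    exact: (mlin_linear (f := fun u : H => lact u h) [::]
      (mlin_catl [:: lact x1 g] (untwist_mlin m)) (lact_linearl h)).
  rewrite (sw_counitr _ hl).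
  rewrite /= comulM.
  have Fb : bilin (fun g1 g2 : H =>
    (antipode g2 * (x2 * (h : H))) *t ract m g1) by lin.
  rewrite (sw_map _ (tensor_lift_linear Fb)); last by lin.
  apply: sw_ext => y1 y2.
  rewrite (sw_map _ (tensor_lift_linear Fb)); last by lin.
  by apply: sw_ext => g1 g2; rewrite sw_pair.
rewrite (sw_coassoc (F := fun y1 y2 x2 => \sw_(g1, g2 <- comul (g : H))
  (antipode (y2 * g2) * (x2 * (h : H))) *t ract m (y1 * g1))); last by lin.
pose K (u : H) := \sw_(g1, g2 <- comul (g : H))
  (antipode g2 * (h : H)) *t ract m (u * g1).
transitivity (K x); first by apply: sw_ext => g1 g2; rewrite ractM.
have Kl : linear K by rewrite /K; lin.
rewrite -(sw_counitr (f := K)) //; apply: sw_ext => y1 l.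
rewrite sw_exchange; [|by lin..].
have sl : linear (fun z : tensor H M => (counit l : k) *: z) by lin.
rewrite (sw_map _ sl); last by lin.
apply: sw_ext => g1 g2.
have hl : linear (fun z : H => (z * (h : H)) *t ract m (y1 * g1)) by lin.
rewrite -(linear_scale _ _ hl) -sw_antipode_mul (sw_map _ hl); last by lin.
by apply: sw_ext => y2 x2; rewrite mulrA.
Qed.

(** Apply tau and then [untwist] to m h (x) 1 (x) 1 = m (x) h1 (x) h2. The left side becomes the
    coaction of m h because S(1) = 1; the right side becomes S(h3) m_(-1) h1 (x) m_0 h2. *)
Lemma tau_descends_ayd :
  descends (cyc_tau M (regular H) 1) -> anti_yetter_drinfeld M.
Proof.
case=> t tE m h; pose one : regular H := (1 : H).
have lift_linear : linear (tensor_lift (fun (m : M) (y : tpow (regular H) 2) =>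
    \swn_(c <- y) untwist m c)).
  apply: tensor_lift_linear; split=> [y|m'].
    by apply: tpow_lift_fun_linear => c; exact: untwist_linear.
  exact/tpow_lift_linear/(mlin_multilin (untwist_mlin m')).
pose phi := tensor_lift (fun (m : M) (y : tpow (regular H) 2) =>
    \swn_(c <- y) untwist m c).
have phiE p s : size s = 2 -> phi (p *t tlist 2 s) = untwist p s.
  move=> sz; rewrite /phi sw_pair ?tpow_lift_tlist //.
    exact: untwist_mlin.
  split=> [y|m']; last exact/tpow_lift_linear/(mlin_multilin (untwist_mlin m')).
  by apply: tpow_lift_fun_linear => c; exact: untwist_linear.
(* [t] takes values in the quotient, so [untwist] has to descend before it can be applied after
   [t]. *)
have [g gE] : exists g : {linear cyc_mod M (regular H) 1 -> tensor H M},
    forall x, g (cyc_proj M (regular H) 1 x) = phi x.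
  apply: balanced_quotient => // p x s sz; rewrite phiE // untwist_balanced //.
  by apply: dact_ext => d ds; rewrite phiE ?ds.
have gtE p (y z : regular H) : g (t (cyc_pure 1 p [:: y; z])) =
    \sw_(a, q <- coact p) untwist q [:: z; lact a y].
  rewrite tE gE cyc_tau_tlist // (sw_map (L := phi)) //; last by lin.
  by apply: sw_ext => a q; rewrite phiE.
have gtl : linear (fun x => g (t x)) by apply: lin_comp; exact: linearP.
have utE := congr1 (fun x => g (t x))
  (cyc_pure_ract m h (erefl : size [:: one; one] = 2)).
move: utE.
rewrite gtE -(dact_map _ _ gtl (@cyc_pure_mlin _ _ _ _ 1 m)) /= => utE.
have untwist1 p (a : regular H) :
    untwist p [:: one; a] = (a : H) *t p.
  by rewrite /= comul1 sw_pair ?antipode1 ?mul1r ?ract1 //; lin.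
transitivity (\sw_(a, q <- coact (ract m h))
    untwist q [:: one; lact a one]).
  rewrite -[LHS]sw_tpair; apply: sw_ext => a q.
  by rewrite untwist1 [lact _ _]mulr1.
rewrite {}utE; apply: sw_ext => h1 h'.
(* The counit removed here is the one that ends [dact] on the list of two factors. *)
rewrite (sw_counitr (f := fun u : H =>
  g (t (cyc_pure 1 m [:: lact h1 one; lact u one])))); last by lin.
rewrite gtE [RHS]sw_exchange; [|by lin..]; apply: sw_ext => a q /=.
rewrite -[lact h' one]/(h' * 1) -[lact h1 one]/(h1 * 1) !mulr1.
by apply: sw_ext => k1 k2; rewrite -mulrA.
Qed.

End Necessity.

(** * Cocyclic identities *)

(** Isolates the last coface. As it equals t d_0, the identities containing it follow formally from
    the others; s_n t d_0 = id and t t d_0 = d_n t are two of its relations, written out through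
    d_0. *)
Lemma cocyclic_of_inner (k : fieldType) (X : nat -> lmodType k)
    (d : forall n, nat -> {linear X n -> X n.+1})
    (s : forall n, nat -> {linear X n.+1 -> X n})
    (t : forall n, {linear X n -> X n}) :
  (forall n i j (x : X n), (i < j <= n.+1)%N ->
     d n.+1 j (d n i x) = d n.+1 i (d n j.-1 x)) ->
  (forall n i j (x : X n.+2), (i <= j <= n)%N ->
     s n j (s n.+1 i x) = s n i (s n.+1 j.+1 x)) ->
  (forall n i j (x : X n.+1), (i < j <= n.+1)%N ->
     s n.+1 j (d n.+1 i x) = d n i (s n j.-1 x)) ->
  (forall n i j (x : X n), (j <= n)%N -> (i <= n)%N ->
     (i == j) || (i == j.+1) -> s n j (d n i x) = x) ->
  (forall n (x : X n), s n n (t n.+1 (d n 0 x)) = x) ->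
  (forall n i j (x : X n.+1), (j.+1 < i <= n.+1)%N ->
     s n.+1 j (d n.+1 i x) = d n i.-1 (s n j x)) ->
  (forall n i (x : X n), (0 < i <= n)%N ->
     t n.+1 (d n i x) = d n i.-1 (t n x)) ->
  (forall n (x : X n), t n.+1 (t n.+1 (d n 0 x)) = d n n (t n x)) ->
  (forall n (x : X n), t n.+1 (d n 0 x) = d n n.+1 x) ->
  (forall n i (x : X n.+1), (0 < i <= n)%N ->
     t n (s n i x) = s n i.-1 (t n.+1 x)) ->
  (forall n (x : X n.+1), t n (s n 0 x) = s n n (t n.+1 (t n.+1 x))) ->
  (forall n (x : X n), iter n.+1 (t n) x = x) ->
  cocyclic d s t.
Proof.
move=> dd ss sd_lt sd_id sd_last sd_gt td td0 d_last ts ts0 t_iter.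
(* At i = n+1 the relation is exactly t t d_0 = d_n t. *)
have td' n i (x : X n) : (0 < i <= n.+1)%N ->
    t n.+1 (d n i x) = d n i.-1 (t n x).
  move=> /andP[i0]; rewrite leq_eqVlt => /orP[/eqP->|le_in]; last first.
    by apply: td; rewrite i0.
  by rewrite -d_last td0.
split=> //.
- move=> n i j x /andP[ij]; rewrite leq_eqVlt => /orP[/eqP jE|jn]; last first.
    by apply: dd; rewrite ij.
  (* For j = n+2, moving [t] to the front on both sides leaves d_0 d_i = d_(i+1) d_0. At i = n+1 the
     last coface occurs again and is removed with d_0 t = t d_1. *)
  have iS : (i < n.+2)%N by rewrite -jE.
  rewrite {}jE /= -!d_last -[i in RHS]/(i.+1.-1) -td' ?iS //; congr (t _ _).
  move: iS; rewrite ltnS leq_eqVlt => /orP[/eqP->|le_in];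
    last by rewrite [RHS]dd.
  by rewrite -!d_last -[in LHS](td' _ 1%N) // dd.
- move=> n i j x jn; case: (leqP i n) => [le_in|]; first exact: sd_id.
  (* Beyond the inner cofaces only i = n+1 with j = n can occur. *)
  move=> ni /orP[] /eqP iE; first by move: ni; rewrite iE ltnNge jn.
  have jE : j = n by apply/eqP; rewrite eqn_leq jn -ltnS -iE.
  by rewrite iE jE -d_last sd_last.
- move=> n i j x /andP[ji]; rewrite leq_eqVlt => /orP[/eqP iE|iN]; last first.
    by apply: sd_gt; rewrite ji.
  (* For i = n+2 the chain is s_j t d_0 = t s_(j+1) d_0 = t d_0 s_j. *)
  have jn : (j < n.+1)%N by move: ji; rewrite iE.
  rewrite {}iE /= -!d_last -[j in LHS]/(j.+1.-1) -ts //.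
  by rewrite sd_lt.
Qed.

(** * The relations on classes of pure tensors *)

Section Relations.
Variables (k : fieldType) (H : hopfAlgType k).
Variables (M : modComodType H) (C : modCoalgType H).
Implicit Types (m : M) (u v w : seq C).

Local Notation X n := (cyc_mod M C n).
Local Notation B n := (@cyc_pure k H M C n).

Lemma induced_delta n i (g : X n -> X n.+1) m u x v :
  induces (cyc_delta M C n i) g -> size u = i -> (i + size v)%N = n ->
  g (B n m (u ++ x :: v)) =
  \sw_(c1, c2 <- comul x) B n.+1 m (u ++ [:: c1, c2 & v]).
Proof.
move=> gE ui uv; rewrite gE -ui cyc_delta_tlist ?ui //.
by rewrite (sw_map (L := cyc_proj M C n.+1)); [|exact: linearP|by lin].
Qed.

Lemma induced_sigma n i (g : X n.+1 -> X n) m u x v :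
  induces (cyc_sigma M C n i) g -> size u = i.+1 -> (i + size v)%N = n ->
  g (B n.+1 m (u ++ x :: v)) = (counit x : k) *: B n m (u ++ v).
Proof.
move=> gE ui uv; rewrite gE -[i]/(i.+1.-1) -ui cyc_sigma_tlist ?ui //.
  exact: (linear_scale _ _ (linearP (cyc_proj M C n))).
by rewrite addSn uv.
Qed.

Lemma induced_tau n (g : X n -> X n) m x v :
  induces (cyc_tau M C n) g -> size v = n ->
  g (B n m (x :: v)) = \sw_(a, p <- coact m) B n p (v ++ [:: lact a x]).
Proof.
move=> gE vn; rewrite gE cyc_tau_tlist ?vn //.
by rewrite (sw_map (L := cyc_proj M C n)); [|exact: linearP|by lin].
Qed.

(** The split [u ++ v] makes the induction go through: each step sends the head of [u] behind [v].
    With [v] empty this computes tau^(n+1). *)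
Lemma iter_tau n (g : {linear X n -> X n}) m u v :
  induces (cyc_tau M C n) g -> (size u + size v)%N = n.+1 ->
  iter (size u) g (B n m (u ++ v)) = cdact m u (fun p d => B n p (v ++ d)).
Proof.
move=> gE; elim: u m v => [|x u IH] m v /=; first by rewrite cats0.
move=> [uv]; rewrite -iterS iterSr (induced_tau m x gE) ?size_cat //.
have il : linear (iter (size u) g).
  by elim: (size u) => //= i; apply: lin_comp; exact: linearP.
rewrite (sw_map _ il); last by lin.
apply: sw_ext => a p; rewrite -catA IH ?size_cat /= ?addn1 ?addnS ?uv //.
by congr cdact; apply/funext => q; apply/funext => d; rewrite -catA.
Qed.

Lemma tau_cyclic n (g : {linear X n -> X n}) x :
  stable M -> induces (cyc_tau M C n) g -> iter n.+1 g x = x.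
Proof.
move=> st gE; have il : linear (iter n.+1 g).
  by elim: n.+1 => [|i IH] //=; apply: lin_comp; [exact: linearP|].
apply: (cyc_mod_ext il (@linear_id _ _)) => m s sn.
have := iter_tau m (u := s) (v := [::]) gE.
rewrite cats0 addn0 sn => -> //.
rewrite cdact_dact; [|by lin..].
rewrite -[in RHS](st m) (sw_map (L := fun m => B n m s)); [|by lin..].
by apply: sw_ext => a p; rewrite cyc_pure_ract.
Qed.

Variables (d : forall n : nat, nat -> {linear X n -> X n.+1}).
Variables (s : forall n : nat, nat -> {linear X n.+1 -> X n}).
Variables (t : forall n : nat, {linear X n -> X n}).
Hypothesis dE : forall n i : nat, (i <= n.+1)%N ->
  induces (cyc_delta M C n i) (d n i).
Hypothesis sE : forall n i : nat, (i <= n)%N ->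
  induces (cyc_sigma M C n i) (s n i).
Hypothesis tE : forall n : nat, induces (cyc_tau M C n) (t n).

(** The splitting of [w] enters as an equation, so the formula applies however the list is
    bracketed. *)
Lemma d_pure n i m w u x v :
  w = u ++ x :: v -> size u = i -> size w = n.+1 ->
  d n i (B n m w) = \sw_(c1, c2 <- comul x) B n.+1 m (u ++ [:: c1, c2 & v]).
Proof.
move=> -> ui; rewrite size_cat /= ui => wn.
have le : (i <= n.+1)%N by lia.
by apply: (induced_delta m x (dE le) ui); lia.
Qed.

Lemma s_pure n i m w u x v :
  w = u ++ x :: v -> size u = i.+1 -> size w = n.+2 ->
  s n i (B n.+1 m w) = (counit x : k) *: B n m (u ++ v).
Proof.
move=> -> ui; rewrite size_cat /= ui => wn.
have le : (i <= n)%N by lia.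
by apply: (induced_sigma m x (sE le) ui); lia.
Qed.

Lemma t_pure n m x v : size v = n ->
  t n (B n m (x :: v)) = \sw_(a, p <- coact m) B n p (v ++ [:: lact a x]).
Proof. by move=> vn; exact: (induced_tau m x (@tE n) vn). Qed.

Lemma cat_split2 w i j : (i < j < size w)%N ->
  exists u x v y z, [/\ w = u ++ x :: v ++ y :: z, size u = i &
    (i + size v).+1 = j].
Proof.
move=> /andP[ij jw]; have [u [y [z [wE uj]]]] := seq_split jw.
have iu : (i < size u)%N by rewrite uj.
have [u' [x [v [uE ui]]]] := seq_split iu.
exists u', x, v, y, z; split=> //; first by rewrite wE uE -catA.
by rewrite -uj uE size_cat /= ui addnS.
Qed.

Ltac solve_size := subst; rewrite ?size_cat /= ?size_cat /=; lia.
Ltac cat_assoc := by rewrite -?catA /= -?catA.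
Ltac ext x := move: x; apply: cyc_mod_ext; [by lin|by lin|].

Lemma inner_coface_coface n i j (x : X n) : (i < j <= n.+1)%N ->
  d n.+1 j (d n i x) = d n.+1 i (d n j.-1 x).
Proof.
move=> /andP[ij jn]; ext x => m w wn; have [jE|ji] := eqVneq j i.+1.
  (* For j = i+1 the same factor is comultiplied twice, and the claim is coassociativity. *)
  have iw : (i < size w)%N by lia.
  have [u [x [v [wE ui]]]] := seq_split iw.
  have uv : (size u + size v).+1 = n.+1 by rewrite -wn wE !size_cat /=; lia.
  rewrite jE /= (d_pure m wE ui wn).
  rewrite (sw_map _ (linearP (d n.+1 i.+1))); last by lin.
  rewrite (sw_map _ (linearP (d n.+1 i))); last by lin.
  transitivity (\sw_(a, b <- comul x) \sw_(b1, b2 <- comul b)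
      B n.+2 m (u ++ [:: a, b1, b2 & v])).
    apply: sw_ext => a b.
    rewrite (@d_pure n.+1 _ m _ (u ++ [:: a]) b v);
      [|by cat_assoc|by solve_size|by solve_size].
    by apply: sw_ext => b1 b2; rewrite -catA.
  rewrite -(sw_coassoc (F := fun a b c => B n.+2 m (u ++ [:: a, b, c & v])));
    last by lin.
  apply: sw_ext => a b.
  by rewrite (@d_pure n.+1 _ m _ u a (b :: v));
    [|by cat_assoc|by solve_size|by solve_size].
(* Otherwise two different factors are comultiplied. In [w] the second sits at j-1, not yet shifted
   by the coface at i. *)
have ij1 : (i < j.-1 < size w)%N by lia.
have [u [x [v [y [z [wE ui vj]]]]]] := cat_split2 ij1.
have uvz : (size u + size v + size z).+2 = n.+1.
  by rewrite -wn wE !size_cat /= size_cat /=; lia.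
rewrite (d_pure m wE ui wn) (sw_map _ (linearP (d n.+1 j))); last by lin.
rewrite (@d_pure n _ m w (u ++ x :: v) y z);
  [|by cat_assoc|by solve_size|by []].
rewrite (sw_map _ (linearP (d n.+1 i))); last by lin.
transitivity (\sw_(x1, x2 <- comul x) \sw_(y1, y2 <- comul y)
    B n.+2 m (u ++ [:: x1, x2 & v ++ [:: y1, y2 & z]])).
  apply: sw_ext => x1 x2.
  rewrite (@d_pure n.+1 _ m _ (u ++ [:: x1, x2 & v]) y z);
    [|by cat_assoc|by solve_size|by solve_size].
  by apply: sw_ext => y1 y2; rewrite -catA.
rewrite sw_exchange; [|by lin..].
apply: sw_ext => y1 y2.
by rewrite (@d_pure n.+1 _ m _ u x (v ++ [:: y1, y2 & z]));
  [|by cat_assoc|by solve_size|by solve_size].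
Qed.

Lemma inner_codeg_codeg n i j (x : X n.+2) : (i <= j <= n)%N ->
  s n j (s n.+1 i x) = s n i (s n.+1 j.+1 x).
Proof.
move=> /andP[ij jn]; ext x => m w wn.
(* sigma_i removes position i+1 of [w], and sigma_(j+1) position j+2. *)
have ij1 : (i.+1 < j.+2 < size w)%N by lia.
have [u [x [v [y [z [wE ui vj]]]]]] := cat_split2 ij1.
have uvz : (size u + size v + size z).+2 = n.+3.
  by rewrite -wn wE !size_cat /= size_cat /=; lia.
rewrite (s_pure m wE ui wn) (linear_scale _ _ (linearP (s n j))).
rewrite (@s_pure n j m _ (u ++ v) y z);
  [|by cat_assoc|by solve_size|by solve_size].
rewrite (@s_pure n.+1 _ m w (u ++ x :: v) y z);
  [|by cat_assoc|by solve_size|by []].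
rewrite (linear_scale _ _ (linearP (s n i))).
rewrite (@s_pure n i m _ u x (v ++ z));
  [|by cat_assoc|by solve_size|by solve_size].
by rewrite -catA !scalerA mulrC.
Qed.

Lemma inner_codeg_coface_lt n i j (x : X n.+1) : (i < j <= n.+1)%N ->
  s n.+1 j (d n.+1 i x) = d n i (s n j.-1 x).
Proof.
move=> /andP[ij jn]; ext x => m w wn.
have ij1 : (i < j < size w)%N by lia.
have [u [x [v [y [z [wE ui vj]]]]]] := cat_split2 ij1.
have uvz : (size u + size v + size z).+2 = n.+2.
  by rewrite -wn wE !size_cat /= size_cat /=; lia.
rewrite (d_pure m wE ui wn) (sw_map _ (linearP (s n.+1 j))); last by lin.
rewrite (@s_pure n _ m w (u ++ x :: v) y z);
  [|by cat_assoc|by solve_size|by []].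
rewrite (linear_scale _ _ (linearP (d n i))).
rewrite (@d_pure n i m _ u x (v ++ z));
  [|by cat_assoc|by solve_size|by solve_size].
have yl : linear (fun w : X n.+1 => (counit y : k) *: w) by lin.
rewrite (sw_map _ yl); last by lin.
apply: sw_ext => x1 x2.
rewrite (@s_pure n.+1 _ m _ (u ++ [:: x1, x2 & v]) y z);
  [|by cat_assoc|by solve_size|by solve_size].
by rewrite -catA.
Qed.

Lemma inner_codeg_coface_id n i j (x : X n) : (j <= n)%N -> (i <= n)%N ->
  (i == j) || (i == j.+1) -> s n j (d n i x) = x.
Proof.
move=> jn le_in ij; move: x; apply: cyc_mod_ext => [||m w wn].
- by apply: lin_comp; exact: linearP.
- exact: linear_id.
have iw : (i < size w)%N by lia.
have [u [x [v [wE ui]]]] := seq_split iw.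
have uv : (size u + size v).+1 = n.+1 by rewrite -wn wE !size_cat /=; lia.
rewrite (d_pure m wE ui wn) (sw_map _ (linearP (s n j))); last by lin.
have xl : linear (fun x => B n m (u ++ x :: v)) by lin.
(* sigma_j removes position j+1, which holds the second leg when i = j and the first leg when i =
   j+1. *)
case/orP: ij => /eqP ij.
  rewrite [in RHS]wE -(sw_counitr _ xl); apply: sw_ext => x1 x2.
  rewrite (@s_pure n _ m _ (u ++ [:: x1]) x2 v);
    [|by cat_assoc|by solve_size|by solve_size].
  by rewrite -catA.
rewrite [in RHS]wE -(sw_counitl _ xl); apply: sw_ext => x1 x2.
by rewrite (@s_pure n _ m _ u x1 (x2 :: v));
  [|by cat_assoc|by solve_size|by solve_size].
Qed.

Lemma inner_codeg_coface_gt n i j (x : X n.+1) : (j.+1 < i <= n.+1)%N ->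
  s n.+1 j (d n.+1 i x) = d n i.-1 (s n j x).
Proof.
move=> /andP[ji le_in]; ext x => m w wn.
have ij1 : (j.+1 < i < size w)%N by lia.
have [u [y [v [x [z [wE uj vi]]]]]] := cat_split2 ij1.
have uvz : (size u + size v + size z).+2 = n.+2.
  by rewrite -wn wE !size_cat /= size_cat /=; lia.
rewrite (s_pure m wE uj wn) (linear_scale _ _ (linearP (d n i.-1))).
rewrite (@d_pure n.+1 _ m w (u ++ y :: v) x z);
  [|by cat_assoc|by solve_size|by []].
rewrite (sw_map _ (linearP (s n.+1 j))); last by lin.
rewrite (@d_pure n _ m _ (u ++ v) x z);
  [|by cat_assoc|by solve_size|by solve_size].
have yl : linear (fun w : X n.+1 => (counit y : k) *: w) by lin.
rewrite (sw_map _ yl); last by lin.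
apply: sw_ext => x1 x2.
rewrite (@s_pure n.+1 _ m _ u y (v ++ [:: x1, x2 & z]));
  [|by cat_assoc|by solve_size|by solve_size].
by rewrite -catA.
Qed.

Lemma inner_cyclic_coface n i (x : X n) : (0 < i <= n)%N ->
  t n.+1 (d n i x) = d n i.-1 (t n x).
Proof.
move=> /andP[i0 le_in]; ext x => m [|x0 w] // [wn].
have iw : (i.-1 < size w)%N by lia.
have [u [x [v [wE ui]]]] := seq_split iw.
have uv : (size u + size v).+1 = n by rewrite -wn wE !size_cat /=; lia.
rewrite (@d_pure n _ m _ (x0 :: u) x v);
  [|by rewrite wE|by solve_size|by solve_size].
rewrite (sw_map _ (linearP (t n.+1))); last by lin.
rewrite t_pure // (sw_map _ (linearP (d n i.-1))); last by lin.
transitivity (\sw_(x1, x2 <- comul x) \sw_(a, p <- coact m)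
    B n.+1 p (u ++ [:: x1, x2 & v ++ [:: lact a x0]])).
  apply: sw_ext => x1 x2; rewrite /= t_pure; last by solve_size.
  by apply: sw_ext => a p; rewrite -catA.
rewrite sw_exchange; [|by lin..].
apply: sw_ext => a p.
by rewrite (@d_pure n _ p _ u x (v ++ [:: lact a x0]));
  [|by rewrite wE; cat_assoc|by solve_size|by solve_size].
Qed.

(** Two rotations carry both legs of the first factor to the end, acted on by two successive
    coaction legs. Coassociativity makes these the legs of a single m_(-1), and Delta(m_(-1) x)
    appears in the last place. *)
Lemma inner_cyclic_coface0 n (x : X n) :
  t n.+1 (t n.+1 (d n 0 x)) = d n n (t n x).
Proof.
ext x => m [|x w] // [wn].
rewrite (@d_pure n _ m _ [::] x w) //=; last by rewrite wn.
rewrite (sw_map _ (linearP (t n.+1))); last by lin.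
transitivity (\sw_(x1, x2 <- comul x) \sw_(a, p <- coact m)
    \sw_(b, q <- coact p) B n.+1 q (w ++ [:: lact a x1; lact b x2])).
  rewrite (sw_map _ (linearP (t n.+1))); last first.
    by split=> z; apply: (lin_comp (linearP (t n.+1))); lin.
  apply: sw_ext => x1 x2; rewrite t_pure; last by rewrite /= wn.
  rewrite (sw_map _ (linearP (t n.+1))); last by lin.
  apply: sw_ext => a p; rewrite t_pure; last by rewrite size_cat /= wn addn1.
  by apply: sw_ext => b q; rewrite -catA.
rewrite t_pure // (sw_map _ (linearP (d n n))); last by lin.
rewrite sw_exchange; [|by lin..].
transitivity (\sw_(a, p <- coact m) \sw_(b, q <- coact p)
    \sw_(x1, x2 <- comul x) B n.+1 q (w ++ [:: lact a x1; lact b x2])).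
  by apply: sw_ext => a p; rewrite sw_exchange //; lin.
rewrite -(sw_assoc (F := fun a b q => \sw_(x1, x2 <- comul x)
  B n.+1 q (w ++ [:: lact a x1; lact b x2])) (f := comul) (x := coact m)) //.
- apply: sw_ext => a p.
  rewrite (@d_pure n _ p _ w (lact a x) [::]) //; last by solve_size.
  by rewrite sw_comul_lact //; lin.
- exact: linearP.
- exact: linearP.
- by lin.
exact: coact_coassoc.
Qed.

Lemma sw_coact_counit (W : lmodType k) (f : M -> W) m : linear f ->
  \sw_(a, p <- coact m) (counit a : k) *: f p = f m.
Proof.
move=> fl; rewrite -[in RHS](coact_counit m) (sw_map _ fl); last by lin.
by apply: sw_ext => a p; rewrite (linear_scale _ _ fl).
Qed.

(** sigma_n meets the rotated leg and yields eps(m_(-1)) eps(x1); the counit rules of the coaction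
    and of [C] absorb one factor each. *)
Lemma inner_codeg_coface_last n (x : X n) : s n n (t n.+1 (d n 0 x)) = x.
Proof.
move: x; apply: cyc_mod_ext => [||m [|x w] // [wn]]; first by lin.
  exact: linear_id.
rewrite (@d_pure n _ m _ [::] x w) //=; last by rewrite wn.
rewrite (sw_map _ (linearP (t n.+1))); last by lin.
rewrite (sw_map _ (linearP (s n n))); last first.
  by split=> z; apply: (lin_comp (linearP (t n.+1))); lin.
rewrite -(sw_counitl (f := fun x => B n m (x :: w))); last by lin.
apply: sw_ext => x1 x2; rewrite t_pure; last by rewrite /= wn.
rewrite (sw_map _ (linearP (s n n))); last by lin.
have xl : linear (fun p => (counit x1 : k) *: B n p (x2 :: w)) by lin.
rewrite -(sw_coact_counit _ xl); apply: sw_ext => a p.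
rewrite (@s_pure n _ p _ (x2 :: w) (lact a x1) [::]) /= ?size_cat /= ?wn //;
  last by rewrite addn1.
by rewrite cats0 counit_lact scalerA.
Qed.

Lemma inner_cyclic_codeg n i (x : X n.+1) : (0 < i <= n)%N ->
  t n (s n i x) = s n i.-1 (t n.+1 x).
Proof.
move=> /andP[i0 le_in]; ext x => m [|x0 w] // [wn].
have iw : (i < size w)%N by lia.
have [u [y [v [wE ui]]]] := seq_split iw.
have uv : (size u + size v)%N = n.
  by move: wn; rewrite wE size_cat /=; lia.
rewrite (@s_pure n _ m _ (x0 :: u) y v);
  [|by rewrite wE|by solve_size|by rewrite /= wn].
rewrite (linear_scale _ _ (linearP (t n))) /= t_pure; last by solve_size.
rewrite t_pure // (sw_map _ (linearP (s n i.-1))); last by lin.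
have yl : linear (fun w : X n => (counit y : k) *: w) by lin.
rewrite (sw_map _ yl); last by lin.
apply: sw_ext => a p.
rewrite (@s_pure n _ p _ u y (v ++ [:: lact a x0]));
  [|by rewrite wE; cat_assoc|by lia|by solve_size].
by rewrite -catA.
Qed.

(** The second rotation puts the second factor [y] last, where sigma_n turns it into eps(b) eps(y);
    the counit rule of the coaction removes eps(b). *)
Lemma inner_cyclic_codeg0 n (x : X n.+1) :
  t n (s n 0 x) = s n n (t n.+1 (t n.+1 x)).
Proof.
ext x => m [|x [|y w]] // [wn].
rewrite (@s_pure n _ m _ [:: x] y w) //=; last by rewrite wn.
rewrite (linear_scale _ _ (linearP (t n))) t_pure // t_pure /= ?wn //.
rewrite (sw_map _ (linearP (t n.+1))); last by lin.
rewrite (sw_map _ (linearP (s n n))); last first.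
  by split=> z; apply: (lin_comp (linearP (t n.+1))); lin.
have yl : linear (fun w : X n => (counit y : k) *: w) by lin.
rewrite (sw_map _ yl); last by lin.
apply: sw_ext => a p; rewrite t_pure; last by rewrite size_cat /= wn addn1.
rewrite (sw_map _ (linearP (s n n))); last by lin.
have xl : linear (fun p => (counit y : k) *: B n p (w ++ [:: lact a x])) by lin.
rewrite -(sw_coact_counit _ xl); apply: sw_ext => b q.
rewrite (@s_pure n _ q _ (w ++ [:: lact a x]) (lact b y) [::]);
  [|by []|by solve_size|by solve_size].
by rewrite cats0 counit_lact scalerA.
Qed.

Lemma cyclic_coface0_pure n (x : X n) : t n.+1 (d n 0 x) = d n n.+1 x.
Proof.
rewrite -[x]modreprK -/(cyc_proj M C n _).
rewrite (dE (leqnn n.+1)) (dE (leq0n n.+1)) tE.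
by rewrite (@cyc_delta_last _ _ _ _ n n.+1).
Qed.

Lemma cocyclic_induced : stable M -> cocyclic d s t.
Proof.
move=> st; apply: cocyclic_of_inner.
- exact: inner_coface_coface.
- exact: inner_codeg_codeg.
- exact: inner_codeg_coface_lt.
- exact: inner_codeg_coface_id.
- exact: inner_codeg_coface_last.
- exact: inner_codeg_coface_gt.
- exact: inner_cyclic_coface.
- exact: inner_cyclic_coface0.
- exact: cyclic_coface0_pure.
- exact: inner_cyclic_codeg.
- exact: inner_cyclic_codeg0.
by move=> n x; exact: tau_cyclic.
Qed.

End Relations.

Theorem theorem2p1 (k : fieldType) (H : hopfAlgType k)
    (antipode_bij : bijective (antipode : H -> H)) (M : modComodType H) :
  ((forall (n : nat) (C : modCoalgType H), descends (cyc_tau M C n)) <->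
   anti_yetter_drinfeld M) /\
  (anti_yetter_drinfeld M -> stable M ->
   forall C : modCoalgType H,
   exists (d : forall n : nat, nat -> {linear cyc_mod M C n -> cyc_mod M C n.+1})
          (s : forall n : nat, nat -> {linear cyc_mod M C n.+1 -> cyc_mod M C n})
          (t : forall n : nat, {linear cyc_mod M C n -> cyc_mod M C n}),
     [/\ forall n i : nat, (i <= n.+1)%N -> induces (cyc_delta M C n i) (d n i),
         forall n i : nat, (i <= n)%N -> induces (cyc_sigma M C n i) (s n i),
         forall n : nat, induces (cyc_tau M C n) (t n)
       & cocyclic d s t]).
Proof.
split; first split=> [tau_desc|ayd n C].
- exact/tau_descends_ayd/tau_desc.
- exact: cyc_tau_descends.
move=> ayd st C.
pose t n := projT1 (cid (@cyc_tau_descends k H M C n ayd)).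
have tE n : induces (cyc_tau M C n) (t n).
  exact: (projT2 (cid (@cyc_tau_descends k H M C n ayd))).
have sigma_ex n i : exists g : {linear cyc_mod M C n.+1 -> cyc_mod M C n},
    (i <= n)%N -> induces (cyc_sigma M C n i) g.
  case: (leqP i n) => [/(cyc_sigma_descends M C)[g gE]|_]; first by exists g.
  (* [s] is total in [i], so an arbitrary default is supplied for i > n: the map induced by
     sigma_0. *)
  by exists (projT1 (cid (cyc_sigma_descends M C (leq0n n)))).
pose s n i := projT1 (cid (sigma_ex n i)).
have delta_ex n i : descends (cyc_delta M C n i).
  case: (leqP i n) => [|ni]; first exact: cyc_delta_descends.
  have [g gE] := @cyc_delta_descends k H M C n 0 (leq0n n).
  (* In [cyc_delta] every index above n denotes the last coface, so t delta_0 induces it. *)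
  exists (t n.+1 \o g : {linear _ -> _}) => x /=.
  by rewrite gE tE (cyc_delta_last _ ni).
pose d n i := projT1 (cid (delta_ex n i)).
have dE n i : (i <= n.+1)%N -> induces (cyc_delta M C n i) (d n i).
  by move=> _; exact: (projT2 (cid (delta_ex n i))).
have sE n i : (i <= n)%N -> induces (cyc_sigma M C n i) (s n i).
  exact: (projT2 (cid (sigma_ex n i))).
by exists d, s, t; split=> //; exact: cocyclic_induced.
Qed.
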